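(* A model of the triangle is given by the complete free DGL $$\mathfrak{L}_2=(\widehat{\mathbb{L}}(\Delta^2),\partial)=(\widehat{\mathbb{L}}(a_0,a_1,a_2,a_{01},a_{12},a_{02},a_{012}),\partial),$$ in which $(\widehat{\mathbb{L}}(a_0,a_1,a_{01}),\partial)$, $(\widehat{\mathbb{L}}(a_1,a_2,a_{12}),\partial)$ and $(\widehat{\mathbb{L}}(a_0,a_2,a_{02}),\partial)$ are Lawrence-Sullivan intervals, whose inclusions in $\mathfrak{L}_2$ give the coface maps, and in which the differential of $a_{012}$ is defined by $$\partial_{a_0}a_{012}=a_{01}*a_{12}*a_{02}^{-1}.$$
   Context: The base field is $\mathbb{Q}$. A differential graded Lie algebra (DGL) is a $\mathbb{Z}$-graded Lie algebra $L$ with a linear derivation $\partial$ of degree $-1$, $\partial^2=0$. $\widehat{\mathbb{L}}(V)=\varprojlim_n\mathbb{L}(V)/\mathbb{L}^{>n}(V)$ is the completion of the free graded Lie algebra. For a differential on it, $\partial_1$ is the linear part. A Maurer-Cartan element is $a\in L_{-1}$ with $\partial a+\frac12[a,a]=0$; then $\partial_a=\partial+\mathrm{ad}_a$ is a differential. For degree $0$ elements, $x*y=\log(\exp x\cdot\exp y)=x+y+\frac12[x,y]+\cdots$ is the Baker-Campbell-Hausdorff product and $x^{-1}=-x$. The Lawrence-Sullivan interval is the complete free DGL $(\widehat{\mathbb{L}}(a,b,x),\partial)$ with $a,b$ Maurer-Cartan elements of degree $-1$, $x$ of degree $0$, and $\partial x=\mathrm{ad}_xb+\sum_{n\ge0}\frac{B_n}{n!}\mathrm{ad}_x^n(b-a)=\mathrm{ad}_xb+\frac{\mathrm{ad}_x}{e^{\mathrm{ad}_x}-1}(b-a)$,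 where $B_n$ are the Bernoulli numbers. ''$(\widehat{\mathbb{L}}(a_i,a_j,a_{ij}),\partial)$ is a Lawrence-Sullivan interval'' means this with $a=a_i$, $b=a_j$, $x=a_{ij}$. $\widehat{\mathbb{L}}(\Delta^n)$ is the free complete graded Lie algebra on generators $a_{i_0\dots i_p}$ of degree $p-1$, $0\le i_0<\dots<i_p\le n$. Being a model of the triangle $\Delta^2$ means: $\partial$ is a well defined differential on $\widehat{\mathbb{L}}(\Delta^2)$; each $a_i$ is a Maurer-Cartan element; the linear part is $\partial_1a_{i_0\dots i_p}=\sum_j(-1)^ja_{i_0\dots\widehat{i_j}\dots i_p}$ (and $\partial_1 a_i=0$); and the cofaces $\delta_i\colon\mathfrak{L}_1\to\mathfrak{L}_2$ ($i=0,1,2$) induced by the order preserving injections $\{0,1\}\to\{0,1,2\}$ missing $i$ (sending the generators of $\mathfrak{L}_1=(\widehat{\mathbb{L}}(a_0,a_1,a_{01}),\partial)$, the Lawrence-Sullivan interval, to the correspondingly reindexed generators) are DGL morphisms. *)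

(* Defs.v *)
From HB Require Import structures.
From mathcomp Require Import all_boot all_order all_algebra.
From mathcomp Require Import boolp.
From mathcomp Require Import ring lra zify.

Set Implicit Arguments.
Unset Strict Implicit.
Unset Printing Implicit Defensive.

Import Order.TTheory GRing.Theory Num.Theory.
Local Open Scope ring_scope.

Definition ksign (i j : int) : rat := (-1) ^ (i * j).

(* [homog k] is the degree k part; the carrier is the direct sum of these
   subspaces. *)
Record gradedLie := GradedLie {
  glie_sort :> lmodType rat;
  homog : int -> glie_sort -> Prop;
  bracket : glie_sort -> glie_sort -> glie_sort;
  homog0 : forall k, homog k 0;
  homogP : forall k c x y, homog k x -> homog k y -> homog k (c *: x + y);
  homog_span : forall x, exists2 s : seq int, uniq s &
    exists2 y : int -> glie_sort,
      forall k, homog k (y k) & x = \sum_(k <- s) y k;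
  homog_indep : forall (s : seq int) (y : int -> glie_sort),
    uniq s -> (forall k, homog k (y k)) -> \sum_(k <- s) y k = 0 ->
    forall k, k \in s -> y k = 0;
  bracketPl : forall c x y z,
    bracket (c *: x + y) z = c *: bracket x z + bracket y z;
  bracketPr : forall c x y z,
    bracket z (c *: x + y) = c *: bracket z x + bracket z y;
  homog_bracket : forall i j x y,
    homog i x -> homog j y -> homog (i + j) (bracket x y);
  bracket_antisym : forall i j x y, homog i x -> homog j y ->
    bracket x y = - (ksign i j *: bracket y x);
  bracket_jacobi : forall i j k x y z,
    homog i x -> homog j y -> homog k z ->
    bracket x (bracket y z) =
      bracket (bracket x y) z + ksign i j *: bracket y (bracket x z)
}.

Arguments homog {g} k x.
Arguments bracket {g} x y.

Record is_derivation (L : gradedLie) (D : L -> L) : Prop := IsDerivation {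
  derivP : forall (c : rat) (x y : L), D (c *: x + y) = c *: D x + D y;
  deriv_homog : forall k x, homog k x -> homog (k - 1) (D x);
  deriv_bracket : forall k (x y : L), homog k x ->
    D (bracket x y) = bracket (D x) y + (-1) ^ k *: bracket x (D y)
}.

Definition is_differential (L : gradedLie) (D : L -> L) : Prop :=
  is_derivation D /\ forall x, D (D x) = 0.

Definition maurer_cartan (L : gradedLie) (D : L -> L) (a : L) : Prop :=
  homog (-1) a /\ D a + 2^-1 *: bracket a a = 0.

Definition twist (L : gradedLie) (D : L -> L) (a x : L) : L :=
  D x + bracket a x.

Record dgl_morphism (L M : gradedLie) (D : L -> L) (D' : M -> M)
    (f : L -> M) : Prop := DglMorphism {
  morP : forall (c : rat) (x y : L), f (c *: x + y) = c *: f x + f y;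
  mor_homog : forall k x, homog k x -> homog k (f x);
  mor_bracket : forall x y, f (bracket x y) = bracket (f x) (f y);
  mor_diff : forall x, f (D x) = D' (f x)
}.

Record gradedSet := GradedSet { gens :> finType; gdeg : gens -> int }.

Definition wdeg (V : gradedSet) (w : seq V) : int := \sum_(x <- w) gdeg x.

(* The completed tensor algebra: arbitrary functions on words, a word being a
   monomial in the generators. *)
Definition series (V : gradedSet) := seq V -> rat.

Section SeriesRing.
Variable V : gradedSet.
Implicit Types (f g h : series V) (w : seq V).

HB.instance Definition _ := gen_eqMixin (series V).
HB.instance Definition _ := gen_choiceMixin (series V).

Definition szero : series V := fun=> 0.
Definition sopp f : series V := fun w => - f w.
Definition sadd f g : series V := fun w => f w + g w.
Definition sscale (c : rat) f : series V := fun w => c * f w.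

Fact saddA : associative sadd.
Proof. by move=> f g h; apply/funext => w; apply: addrA. Qed.
Fact saddC : commutative sadd.
Proof. by move=> f g; apply/funext => w; apply: addrC. Qed.
Fact sadd0 : left_id szero sadd.
Proof. by move=> f; apply/funext => w; apply: add0r. Qed.
Fact saddN : left_inverse szero sopp sadd.
Proof. by move=> f; apply/funext => w; apply: addNr. Qed.

HB.instance Definition _ :=
  GRing.isZmodule.Build (series V) saddA saddC sadd0 saddN.

Fact sscaleA a b f : sscale a (sscale b f) = sscale (a * b) f.
Proof. by apply/funext => w; apply: mulrA. Qed.
Fact sscale1 : left_id 1 sscale.
Proof. by move=> f; apply/funext => w; apply: mul1r. Qed.
Fact sscaleDr : right_distributive sscale +%R.
Proof. by move=> a f g; apply/funext => w; apply: mulrDr. Qed.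
Fact sscaleDl f : {morph sscale^~ f : a b / a + b}.
Proof. by move=> a b; apply/funext => w; apply: mulrDl. Qed.

HB.instance Definition _ := GRing.Zmodule_isLmodule.Build rat (series V)
  sscaleA sscale1 sscaleDr sscaleDl.

Definition sone : series V := fun w => (w == [::])%:R.

(* Multiplication is concatenation of words, extended bilinearly. *)
Definition smul f g : series V :=
  fun w => \sum_(i < (size w).+1) f (take i w) * g (drop i w).

Lemma smul_nil f g : smul f g [::] = f [::] * g [::].
Proof. by rewrite /smul big_ord1. Qed.

Lemma smul_cons f g x w :
  smul f g (x :: w) =
    f [::] * g (x :: w) + smul (fun u => f (x :: u)) g w.
Proof. by rewrite /smul big_ord_recl. Qed.

Fact smulDl : left_distributive smul +%R.
Proof.
move=> f g h; apply/funext => w.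
rewrite [RHS](_ : _ = smul f h w + smul g h w) // -big_split /=.
by apply: eq_bigr => i _; apply: mulrDl.
Qed.
Fact smulDr : right_distributive smul +%R.
Proof.
move=> f g h; apply/funext => w.
rewrite [RHS](_ : _ = smul f g w + smul f h w) // -big_split /=.
by apply: eq_bigr => i _; apply: mulrDr.
Qed.
Fact smul_scalel c f g : c *: smul f g = smul (c *: f) g.
Proof.
apply/funext => w; rewrite /smul [LHS]mulr_sumr.
by apply: eq_bigr => i _; apply: mulrA.
Qed.
Fact smul_scaler c f g : c *: smul f g = smul f (c *: g).
Proof.
apply/funext => w; rewrite /smul [LHS]mulr_sumr.
by apply: eq_bigr => i _; apply: mulrCA.
Qed.

Fact smulA : associative smul.
Proof.
move=> f g h; apply/funext => w; elim: w f => [|x w IH] f.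
  by rewrite !smul_nil mulrA.
rewrite !smul_cons !smul_nil mulrDr mulrA -addrA; congr (_ + _).
rewrite IH.
have -> : (fun u => smul f g (x :: u)) =
  f [::] *: ((fun u => g (x :: u)) : series V)
    + smul (fun u => f (x :: u)) g.
  by apply/funext => u; rewrite smul_cons.
by rewrite smulDl -smul_scalel.
Qed.

Fact smul1l : left_id sone smul.
Proof.
move=> f; apply/funext => -[|x w]; first by rewrite smul_nil mul1r.
rewrite smul_cons mul1r /smul big1 ?addr0 // => i _.
by rewrite /sone mul0r.
Qed.
Fact smul1r : right_id sone smul.
Proof.
move=> f; apply/funext => w; elim: w f => [|x w IH] f.
  by rewrite smul_nil mulr1.
by rewrite smul_cons mulr0 add0r IH.
Qed.
Fact sone_neq0 : sone != 0.
Proof. by apply/eqP => /(congr1 (@^~ [::])) /eqP; rewrite oner_eq0. Qed.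

HB.instance Definition _ := GRing.Zmodule_isNzRing.Build (series V)
  smulA smul1l smul1r smulDl smulDr sone_neq0.
HB.instance Definition _ := GRing.Lmodule_isLalgebra.Build rat (series V)
  smul_scalel.
HB.instance Definition _ := GRing.Lalgebra_isAlgebra.Build rat (series V)
  smul_scaler.

Definition letter (x : V) : series V := fun w => (w == [:: x])%:R.

(* The bilinear extension of [u, v] = uv - (-1)^(|u||v|) vu on words. *)
Definition sbracket f g : series V := fun w =>
  \sum_(i < (size w).+1)
    (f (take i w) * g (drop i w)
     - ksign (wdeg (take i w)) (wdeg (drop i w))
         * (f (drop i w) * g (take i w))).

Definition shomog (k : int) f : Prop := forall w, f w != 0 -> wdeg w = k.

(* Sum of a family in which F n vanishes on the words of length < n, so that
   the tail n > size w does not contribute to the coefficient of w. *)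
Definition ssum (F : nat -> series V) : series V :=
  fun w => \sum_(n < (size w).+1) F n w.

Lemma ssum_limit (F : nat -> series V) :
  (forall n w, (size w < n)%N -> F n w = 0) ->
  forall w N, (size w < N)%N -> (\sum_(n < N) F n) w = ssum F w.
Proof.
move=> F0 w N ltwN.
have -> : (\sum_(n < N) F n) w = \sum_(n < N) F n w.
  elim: N {ltwN} => [|N IH]; first by rewrite !big_ord0.
  by rewrite !big_ord_recr /= -IH.
rewrite -(subnKC ltwN) big_split_ord /= [X in _ + X]big1 ?addr0 // => i _.
by apply: F0; rewrite leq_addr.
Qed.

(* For f without constant term. *)
Definition sexp f : series V := ssum (fun n => (n`!%:R)^-1 *: f ^+ n).

(* For u with constant term 1; the index is shifted by one. *)
Definition slog (u : series V) : series V :=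
  ssum (fun n => ((-1) ^+ n / n.+1%:R) *: (u - 1) ^+ n.+1).

Definition bch f g : series V := slog (sexp f * sexp g).

(* Over a field of characteristic 0, the free graded Lie algebra on V is the
   graded Lie subalgebra generated by V in the tensor algebra. *)
Inductive free_lie : series V -> Prop :=
| free_lie_gen x : free_lie (letter x)
| free_lie_zero : free_lie 0
| free_lie_lin c f g : free_lie f -> free_lie g -> free_lie (c *: f + g)
| free_lie_bracket f g :
    free_lie f -> free_lie g -> free_lie (sbracket f g).

(* The inverse limit of the quotients of [free_lie] by the elements of word
   length > n, taken degree by degree: an element of the completion has only
   finitely many homogeneous components, each of them possibly an infinite
   series. *)
Definition in_hatL f : Prop :=
  (exists N : nat, forall w, f w != 0 -> `|wdeg w| <= N%:Z) /\
  (forall n, exists2 p, free_lie p & forall w, (size w <= n)%N -> f w = p w).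

Definition hatL_pred : {pred series V} := fun f => `[< in_hatL f >].

Lemma ksignE i j : ksign i j = 1 \/ ksign i j = -1.
Proof.
have aux n : (-1 : rat) ^+ n = 1 \/ (-1 : rat) ^+ n = -1.
  by rewrite -signr_odd; case: (odd n); [right|left].
rewrite /ksign; case: (i * j) => n; first by rewrite -exprnP.
rewrite NegzE -exprnN; case: (aux n.+1) => ->; [left|right].
  exact: invr1.
by rewrite invrN1.
Qed.

Lemma ksignC i j : ksign i j = ksign j i.
Proof. by rewrite /ksign mulrC. Qed.

Lemma ksignDr i j k : ksign i (j + k) = ksign i j * ksign i k.
Proof. by rewrite /ksign mulrDr expfzDr. Qed.

Lemma series_sumE I (r : seq I) (P : pred I) (F : I -> series V) w :
  (\sum_(i <- r | P i) F i) w = \sum_(i <- r | P i) F i w.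
Proof. exact: (big_morph (fun f : series V => f w)). Qed.

Lemma wdeg_cat (u v : seq V) : wdeg (u ++ v) = wdeg u + wdeg v.
Proof. by rewrite /wdeg big_cat. Qed.

Lemma wdeg_take_drop i w : wdeg w = wdeg (take i w) + wdeg (drop i w).
Proof. by rewrite -wdeg_cat cat_take_drop. Qed.

Lemma sbracketPl (c : rat) f g h :
  sbracket (c *: f + g) h = c *: sbracket f h + sbracket g h.
Proof.
apply/funext => w.
rewrite [RHS](_ : _ = c * sbracket f h w + sbracket g h w) //.
rewrite /sbracket mulr_sumr -big_split /=; apply: eq_bigr => i _.
rewrite [(c *: f + g) _](_ : _ = c * f (take i w) + g (take i w)) //.
rewrite [(c *: f + g) _](_ : _ = c * f (drop i w) + g (drop i w)) //.
ring.
Qed.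

Lemma sbracketPr (c : rat) f g h :
  sbracket h (c *: f + g) = c *: sbracket h f + sbracket h g.
Proof.
apply/funext => w.
rewrite [RHS](_ : _ = c * sbracket h f w + sbracket h g w) //.
rewrite /sbracket mulr_sumr -big_split /=; apply: eq_bigr => i _.
rewrite [(c *: f + g) _](_ : _ = c * f (drop i w) + g (drop i w)) //.
rewrite [(c *: f + g) _](_ : _ = c * f (take i w) + g (take i w)) //.
ring.
Qed.

Lemma sbracketE i j f g : shomog i f -> shomog j g ->
  sbracket f g = f * g - ksign i j *: (g * f).
Proof.
move=> hf hg; apply/funext => w.
rewrite [RHS](_ : _ = smul f g w - ksign i j * smul g f w) //.
rewrite /smul mulr_sumr -sumrB; apply: eq_bigr => n _.
congr (_ - _); rewrite [in RHS](mulrC (g _)).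
have [->|/hf ->] := eqVneq (f (drop n w)) 0; first by rewrite mul0r !mulr0.
have [->|/hg ->] := eqVneq (g (take n w)) 0; first by rewrite !mulr0.
by rewrite ksignC.
Qed.

Lemma shomog0 k : shomog k 0.
Proof. by move=> w; rewrite eqxx. Qed.

Lemma shomogP k (c : rat) f g : shomog k f -> shomog k g -> shomog k (c *: f + g).
Proof.
move=> hf hg w; rewrite [(c *: f + g) w](_ : _ = c * f w + g w) //.
have [->|/hf //] := eqVneq (f w) 0.
by rewrite mulr0 add0r => /hg.
Qed.

Lemma sbracket_supp f g w : sbracket f g w != 0 ->
  exists2 uv, uv.1 ++ uv.2 = w &
    (f uv.1 != 0) && (g uv.2 != 0) || (f uv.2 != 0) && (g uv.1 != 0).
Proof.
move=> nz; apply: contrapT => H; move/negP: nz; apply; apply/eqP.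
rewrite /sbracket big1 // => i _; apply: contrapT => nz; apply: H.
exists (take i w, drop i w); first exact: cat_take_drop.
rewrite /=; have [A|A] := eqVneq (f (take i w)) 0;
  have [B|B] := eqVneq (g (drop i w)) 0;
  have [C|C] := eqVneq (f (drop i w)) 0;
  have [D|D] := eqVneq (g (take i w)) 0 => //=; case: nz;
  by rewrite ?A ?B ?C ?D !(mul0r, mulr0) ?subrr.
Qed.

Lemma shomog_bracket i j f g :
  shomog i f -> shomog j g -> shomog (i + j) (sbracket f g).
Proof.
move=> hf hg w /sbracket_supp[[u v] /= <-]; rewrite wdeg_cat.
by case/orP=> /andP[/hf -> /hg ->] //; rewrite addrC.
Qed.

Lemma sbracket_antisym i j f g : shomog i f -> shomog j g ->
  sbracket f g = - (ksign i j *: sbracket g f).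
Proof.
move=> hf hg; rewrite (sbracketE hf hg) (sbracketE hg hf) (ksignC j i).
by case: (ksignE i j) => ->; rewrite ?scaleN1r ?scale1r ?opprB ?opprK // addrC.
Qed.

Lemma sbracket_jacobi i j k f g h :
  shomog i f -> shomog j g -> shomog k h ->
  sbracket f (sbracket g h) =
    sbracket (sbracket f g) h + ksign i j *: sbracket g (sbracket f h).
Proof.
move=> hf hg hh.
rewrite (sbracketE hf (shomog_bracket hg hh)).
rewrite (sbracketE (shomog_bracket hf hg) hh).
rewrite (sbracketE hg (shomog_bracket hf hh)).
rewrite (sbracketE hf hg) (sbracketE hg hh) (sbracketE hf hh).
rewrite (ksignC (i + j)) !ksignDr (ksignC j i) (ksignC k i) (ksignC k j).
rewrite !(mulrBr, mulrBl) -!(scalerAr, scalerAl) !mulrA.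
set A := _ * _ * _; set B := _ * _ * _; set C := _ * _ * _.
set D := (h * g * f); set E := g * f * h; set F := h * f * g; set G := g * h * f.
have P p (c : rat) (q : series V) w : (p + c *: q) w = p w + c * q w by [].
have N (p q : series V) w : (p - q) w = p w - q w by [].
have S (c : rat) (q : series V) w : (c *: q) w = c * q w by [].
apply/funext => w; rewrite ?(P, N, S).
by case: (ksignE i j) => ->; case: (ksignE i k) => ->; case: (ksignE j k) => ->;
  ring.
Qed.

Definition sproj (k : int) f : series V :=
  fun w => if wdeg w == k then f w else 0.

Lemma sproj_homog k f : shomog k (sproj k f).
Proof. by move=> w; rewrite /sproj; case: (_ =P k) => //; rewrite eqxx. Qed.

Lemma sprojD k f g : sproj k (f + g) = sproj k f + sproj k g.
Proof.
apply/funext => w; rewrite [RHS](_ : _ = sproj k f w + sproj k g w) //.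
by rewrite /sproj; case: ifP; rewrite ?addr0.
Qed.

Lemma sprojZ k (c : rat) f : sproj k (c *: f) = c *: sproj k f.
Proof.
apply/funext => w; rewrite [RHS](_ : _ = c * sproj k f w) //.
by rewrite /sproj; case: ifP; rewrite ?mulr0.
Qed.

Lemma sproj_id k f : shomog k f -> sproj k f = f.
Proof.
move=> hf; apply/funext => w; rewrite /sproj; case: eqP => // ne.
by have [//|/hf] := eqVneq (f w) 0.
Qed.

Lemma sproj_neq j k f : shomog j f -> j != k -> sproj k f = 0.
Proof.
move=> hf ne; apply/funext => w; rewrite /sproj; case: eqP => // e.
have [//|/hf wj] := eqVneq (f w) 0.
by rewrite -wj e eqxx in ne.
Qed.

Inductive lie_span : series V -> Prop :=
| lie_span_zero : lie_span 0
| lie_span_add k f g : shomog k f -> free_lie f -> lie_span g ->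
    lie_span (f + g).

Lemma lie_span1 k f : shomog k f -> free_lie f -> lie_span f.
Proof.
by move=> hf lf; rewrite -(addr0 f); apply: lie_span_add hf lf lie_span_zero.
Qed.

Lemma lie_spanD f g : lie_span f -> lie_span g -> lie_span (f + g).
Proof.
elim=> [|k {}f h hf lf _ IH] sg; first by rewrite add0r.
by rewrite -addrA; apply: lie_span_add hf lf (IH sg).
Qed.

Lemma lie_spanZ (c : rat) f : lie_span f -> lie_span (c *: f).
Proof.
elim=> [|k {}f h hf lf _ IH]; first by rewrite scaler0; left.
rewrite scalerDr; apply: (lie_span_add (k := k)) => //.
  by rewrite -(addr0 (c *: f)); apply: shomogP => //; apply: shomog0.
by rewrite -(addr0 (c *: f)); apply: free_lie_lin => //; apply: free_lie_zero.
Qed.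

Lemma sbracketDl f g h : sbracket (f + g) h = sbracket f h + sbracket g h.
Proof. by have := sbracketPl 1 f g h; rewrite !scale1r. Qed.

Lemma sbracketDr f g h : sbracket h (f + g) = sbracket h f + sbracket h g.
Proof. by have := sbracketPr 1 f g h; rewrite !scale1r. Qed.

Lemma sbracket0l f : sbracket 0 f = 0.
Proof. by apply: (addrI (sbracket 0 f)); rewrite -sbracketDl !addr0. Qed.

Lemma sbracketr0 f : sbracket f 0 = 0.
Proof. by apply: (addrI (sbracket f 0)); rewrite -sbracketDr !addr0. Qed.

Lemma lie_span_bracket f g :
  lie_span f -> lie_span g -> lie_span (sbracket f g).
Proof.
elim=> [|k {}f h hf lf _ IH] sg; first by rewrite sbracket0l; left.
rewrite sbracketDl; apply: lie_spanD (IH sg).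
elim: sg => [|j g1 g2 hg lg _ IH']; first by rewrite sbracketr0; left.
rewrite sbracketDr; apply: lie_span_add IH'; last exact: free_lie_bracket.
exact: shomog_bracket hf hg.
Qed.

Lemma letter_homog x : shomog (gdeg x) (letter x).
Proof.
move=> w; rewrite /letter; have [-> _|] := eqVneq w [:: x].
  by rewrite /wdeg big_seq1.
by rewrite eqxx.
Qed.

Lemma free_lie_span f : free_lie f -> lie_span f.
Proof.
elim=> [x||c {}f g _ sf _ sg|{}f g _ sf _ sg].
- by apply: lie_span1 (free_lie_gen x); apply: letter_homog.
- by left.
- exact/lie_spanD/sg/lie_spanZ.
- exact: lie_span_bracket.
Qed.

Lemma free_lie_proj k f : free_lie f -> free_lie (sproj k f).
Proof.
move/free_lie_span; elim=> [|j {}f g hf lf _ IH].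
  by rewrite (sproj_id (shomog0 k)); apply: free_lie_zero.
rewrite sprojD -[sproj k f]scale1r; apply: free_lie_lin IH.
have [e|ne] := eqVneq j k; first by rewrite sproj_id // -e.
by rewrite (sproj_neq hf ne); apply: free_lie_zero.
Qed.

Lemma in_hatL0 : in_hatL 0.
Proof.
split; first by exists 0 => w; rewrite eqxx.
by move=> n; exists 0 => //; apply: free_lie_zero.
Qed.

Lemma in_hatLP (c : rat) f g :
  in_hatL f -> in_hatL g -> in_hatL (c *: f + g).
Proof.
have E (p q : series V) w : (c *: p + q) w = c * p w + q w by [].
move=> [[N bf] af] [[M bg] ag]; split.
  exists (N + M)%N => w; rewrite E.
  have [->|/bf] := eqVneq (f w) 0; first rewrite mulr0 add0r => /bg; lia.
move=> n; have [p lp ep] := af n; have [q lq eq] := ag n.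
exists (c *: p + q); first exact: free_lie_lin.
by move=> w le; rewrite !E ep // eq.
Qed.

Lemma in_hatL_bracket f g :
  in_hatL f -> in_hatL g -> in_hatL (sbracket f g).
Proof.
move=> [[N bf] af] [[M bg] ag]; split.
  exists (N + M)%N => w /sbracket_supp[[u v] /= <-]; rewrite wdeg_cat.
  case/orP=> /andP[/bf + /bg]; lia.
move=> n; have [p lp ep] := af n; have [q lq eq] := ag n.
exists (sbracket p q); first exact: free_lie_bracket.
move=> w le; apply: eq_bigr => i _.
have lt : (size (take i w) <= n)%N by rewrite size_take; case: ifP; lia.
have ld : (size (drop i w) <= n)%N by rewrite size_drop; lia.
by rewrite !ep ?eq.
Qed.

Lemma in_hatL_proj k f : in_hatL f -> in_hatL (sproj k f).
Proof.
move=> [[N bf] af]; split.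
  by exists N => w; rewrite /sproj; case: ifP => [_ /bf|_]; rewrite ?eqxx.
move=> n; have [p lp ep] := af n.
exists (sproj k p); first exact: free_lie_proj.
by move=> w le; rewrite /sproj; case: ifP => // _; apply: ep.
Qed.

Lemma in_hatL_letter x : in_hatL (letter x).
Proof.
split; first by exists `|gdeg x|%N => w /letter_homog ->; lia.
by move=> n; exists (letter x) => //; apply: free_lie_gen.
Qed.

Fact hatL_submod : submod_closed hatL_pred.
Proof.
split; first exact/asboolP/in_hatL0.
by move=> c f g /asboolP hf /asboolP hg; apply/asboolP/in_hatLP.
Qed.

HB.instance Definition _ :=
  GRing.isSubmodClosed.Build rat (series V) hatL_pred
    (GRing.submod_closed_semi hatL_submod).

Record hatL_type := HatL {
  hatL_val :> series V;
  hatL_valP : hatL_val \in hatL_pred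
}.

HB.instance Definition _ := [isSub for hatL_val].
HB.instance Definition _ := [Choice of hatL_type by <:].
HB.instance Definition _ := [SubChoice_isSubLmodule of hatL_type by <:].

End SeriesRing.

Section CompleteFreeLie.
Variable V : gradedSet.
Implicit Types x y z : hatL_type V.

Lemma hatL_inj x y : hatL_val x = hatL_val y -> x = y.
Proof. exact: (@val_inj _ _ (hatL_type V)). Qed.

Lemma hatL_in x : in_hatL (hatL_val x).
Proof. exact/asboolP/hatL_valP. Qed.

Definition mk_hatL (f : series V) (H : in_hatL f) : hatL_type V :=
  HatL (introT (asboolP _) H).

Definition hatL_bracket x y : hatL_type V :=
  mk_hatL (in_hatL_bracket (hatL_in x) (hatL_in y)).

Definition hatL_proj k x : hatL_type V := mk_hatL (in_hatL_proj k (hatL_in x)).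

Definition hatL_homog k x : Prop := shomog k (hatL_val x).

Lemma hatL_val_sum I (r : seq I) (F : I -> hatL_type V) :
  hatL_val (\sum_(i <- r) F i) = \sum_(i <- r) hatL_val (F i).
Proof. exact: (raddf_sum (\val : hatL_type V -> series V)). Qed.

Fact hatL_homog0 k : hatL_homog k 0.
Proof. exact: shomog0. Qed.

Fact hatL_homogP k (c : rat) x y :
  hatL_homog k x -> hatL_homog k y -> hatL_homog k (c *: x + y).
Proof. exact: shomogP. Qed.

Fact hatL_homog_span x : exists2 s : seq int, uniq s &
  exists2 y : int -> hatL_type V,
    forall k, hatL_homog k (y k) & x = \sum_(k <- s) y k.
Proof.
have [[N bx] _] := hatL_in x.
set s := [seq k%:Z - N%:Z | k <- iota 0 (N + N).+1].
have us : uniq s by rewrite map_inj_uniq ?iota_uniq // => i j; lia.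
exists s => //; exists (hatL_proj^~ x) => [k|]; first exact: sproj_homog.
apply: hatL_inj; apply/funext => w; rewrite hatL_val_sum series_sumE.
have [x0|nz] := eqVneq (hatL_val x w) 0.
  by rewrite big1 // => k _; rewrite /= /sproj x0; case: ifP.
have ws : wdeg w \in s.
  have bw := bx w nz.
  apply/mapP; exists (absz (wdeg w + N%:Z)); last lia.
  by rewrite mem_iota; lia.
rewrite (bigD1_seq _ ws us) /= /sproj eqxx big1 ?addr0 // => k ne.
by rewrite eq_sym (negbTE ne).
Qed.

Fact hatL_homog_indep (s : seq int) (y : int -> hatL_type V) :
  uniq s -> (forall k, hatL_homog k (y k)) -> \sum_(k <- s) y k = 0 ->
  forall k, k \in s -> y k = 0.
Proof.
move=> us hy s0 k ks; apply: hatL_inj; apply/funext => w.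
have := congr1 (fun z => hatL_val z w) s0.
rewrite hatL_val_sum series_sumE (bigD1_seq k) //=.
have [-> //|nz] := eqVneq (hatL_val (y k) w) 0.
rewrite big1 ?addr0 // => j ne.
have [//|/hy wj] := eqVneq (hatL_val (y j) w) 0.
by move: (hy _ _ nz) ne; rewrite wj => ->; rewrite eqxx.
Qed.

Fact hatL_bracketPl (c : rat) x y z :
  hatL_bracket (c *: x + y) z = c *: hatL_bracket x z + hatL_bracket y z.
Proof. by apply: hatL_inj; apply: sbracketPl. Qed.

Fact hatL_bracketPr (c : rat) x y z :
  hatL_bracket z (c *: x + y) = c *: hatL_bracket z x + hatL_bracket z y.
Proof. by apply: hatL_inj; apply: sbracketPr. Qed.

Fact hatL_homog_bracket i j x y :
  hatL_homog i x -> hatL_homog j y -> hatL_homog (i + j) (hatL_bracket x y).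
Proof. exact: shomog_bracket. Qed.

Fact hatL_antisym i j x y : hatL_homog i x -> hatL_homog j y ->
  hatL_bracket x y = - (ksign i j *: hatL_bracket y x).
Proof. by move=> hx hy; apply: hatL_inj; apply: sbracket_antisym hx hy. Qed.

Fact hatL_jacobi i j k x y z :
  hatL_homog i x -> hatL_homog j y -> hatL_homog k z ->
  hatL_bracket x (hatL_bracket y z) =
    hatL_bracket (hatL_bracket x y) z
      + ksign i j *: hatL_bracket y (hatL_bracket x z).
Proof.
by move=> hx hy hz; apply: hatL_inj; apply: sbracket_jacobi hx hy hz.
Qed.

Definition hatL : gradedLie :=
  GradedLie hatL_homog0 hatL_homogP hatL_homog_span hatL_homog_indep
    hatL_bracketPl hatL_bracketPr hatL_homog_bracket hatL_antisym hatL_jacobi.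

Definition coefs (x : hatL) : series V := hatL_val x.

Definition hatL_gen (v : V) : hatL := mk_hatL (in_hatL_letter v).

End CompleteFreeLie.

Section Pushforward.
Variables (V W : gradedSet) (h : V -> W).
Hypothesis deg_h : forall v, gdeg (h v) = gdeg v.

(* The continuous algebra morphism sending the letter v to the letter h v. *)
Definition push (f : series V) : series W := fun w =>
  \sum_(u : (size w).-tuple V | map h u == w) f u.

Lemma push_nil f : push f [::] = f [::].
Proof.
rewrite /push (bigD1 [tuple]) //= big1 ?addr0 // => u.
by rewrite (tuple0 u) => /andP[_ /eqP].
Qed.

Lemma push_cons f y w :
  push f (y :: w) = \sum_(x : V | h x == y) push (fun u => f (x :: u)) w.
Proof.
rewrite /push pair_big_dep /=.
rewrite (reindex (fun p : V * (size w).-tuple V => [tuple of p.1 :: p.2])) /=.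
  by apply: eq_bigl => -[x u] /=; rewrite eqseq_cons.
exists (fun u : (size w).+1.-tuple V => (thead u, [tuple of behead u])).
  by move=> [x u] _; congr (_, _); apply: val_inj.
by move=> u _; rewrite [RHS]tuple_eta.
Qed.

Lemma pushP (c : rat) f g : push (c *: f + g) = c *: push f + push g.
Proof.
apply/funext => w; rewrite [RHS](_ : _ = c * push f w + push g w) //.
by rewrite /push mulr_sumr -big_split.
Qed.

Lemma push0 : push 0 = 0.
Proof. by apply/funext => w; rewrite /push big1. Qed.

Lemma pushD f g : push (f + g) = push f + push g.
Proof. by rewrite -[f]scale1r pushP !scale1r. Qed.

Lemma pushZ (c : rat) f : push (c *: f) = c *: push f.
Proof. by rewrite -[c *: f]addr0 pushP push0 addr0. Qed.

Lemma push1 : push 1 = 1.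
Proof.
apply/funext => -[|y w]; first exact: push_nil.
by rewrite push_cons big1 // => x _; rewrite /push big1.
Qed.

Lemma pushM f g : push (f * g) = push f * push g.
Proof.
apply/funext => w; elim: w f => [|y w IH] f.
  by rewrite push_nil [LHS]smul_nil [RHS]smul_nil !push_nil.
rewrite push_cons [RHS]smul_cons push_nil push_cons mulr_sumr.
have -> : (fun u => push f (y :: u)) =
    \sum_(x : V | h x == y) push (fun u => f (x :: u)).
  by apply/funext => u; rewrite push_cons series_sumE.
have -> : smul (\sum_(x : V | h x == y) push (fun u => f (x :: u))) (push g) w
  = \sum_(x : V | h x == y) smul (push (fun u => f (x :: u))) (push g) w.
  exact: etrans (congr1 (fun p : series W => p w) (mulr_suml _ _ _ _))
                (series_sumE _ _ _ _).
rewrite -big_split; apply: eq_bigr => x _ /=.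
rewrite -[X in _ + X](IH (fun u => f (x :: u))).
have -> : (fun u => (f * g) (x :: u)) =
  f [::] *: ((fun u => g (x :: u)) : series V)
    + ((fun u => f (x :: u)) : series V) * g.
  by apply/funext => u; apply: smul_cons.
by rewrite pushP.
Qed.

Lemma push_letter v : push (letter v) = letter (h v).
Proof.
apply/funext => -[|y w]; first by rewrite push_nil.
rewrite push_cons.
have E x : push (fun u => letter v (x :: u)) w
    = (x == v)%:R * (w == [::])%:R.
  have -> : (fun u => letter v (x :: u)) = (x == v)%:R *: (1 : series V).
    apply/funext => u; rewrite /letter eqseq_cons -mulnb natrM.
    by [].
  by rewrite pushZ push1.
under eq_bigr do rewrite E.
rewrite -mulr_suml /letter eqseq_cons -mulnb natrM; congr (_ * _).
rewrite big_mkcond (bigD1 v) //= eqxx [y == _]eq_sym.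
rewrite big1 ?addr0 => [|x /negbTE ->]; first by case: eqP.
by case: ifP.
Qed.

Lemma push_wdeg (u : seq V) : wdeg (map h u) = wdeg u.
Proof. by rewrite /wdeg big_map; apply: eq_bigr => v _; apply: deg_h. Qed.

Lemma push_supp f w : push f w != 0 -> exists2 u, map h u = w & f u != 0.
Proof.
move=> nz; apply: contrapT => H; move/eqP: nz; apply.
rewrite /push big1 // => u /eqP e; apply: contrapT => /eqP nz; apply: H.
by exists u.
Qed.

Lemma push_homog k f : shomog k f -> shomog k (push f).
Proof. by move=> hf w /push_supp[u <- /hf <-]; apply: push_wdeg. Qed.

Lemma push_bracket_homog i j f g : shomog i f -> shomog j g ->
  push (sbracket f g) = sbracket (push f) (push g).
Proof.
move=> hf hg; rewrite (sbracketE hf hg).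
rewrite (sbracketE (push_homog hf) (push_homog hg)).
by rewrite -scaleNr pushD pushZ !pushM scaleNr.
Qed.

Lemma push_bracket_span f g : lie_span f -> lie_span g ->
  push (sbracket f g) = sbracket (push f) (push g).
Proof.
move=> sf sg; elim: sf => [|k {}f f' hf _ _ IH].
  by rewrite sbracket0l push0 sbracket0l.
rewrite sbracketDl !pushD sbracketDl IH; congr (_ + _).
elim: sg {IH} => [|j {}g g' hg _ _ IH']; first by rewrite sbracketr0 push0 sbracketr0.
by rewrite sbracketDr !pushD sbracketDr IH' (push_bracket_homog hf hg).
Qed.

Lemma free_lie_push f : free_lie f -> free_lie (push f).
Proof.
elim=> [v||c {}f g _ lf _ lg|{}f g lf plf lg plg].
- by rewrite push_letter; apply: free_lie_gen.
- by rewrite push0; apply: free_lie_zero.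
- by rewrite pushP; apply: free_lie_lin.
- by rewrite push_bracket_span; [apply: free_lie_bracket| |];
    try exact: free_lie_span.
Qed.

Lemma in_hatL_push f : in_hatL f -> in_hatL (push f).
Proof.
move=> [[N bf] af]; split.
  by exists N => w /push_supp[u <- /bf]; rewrite push_wdeg.
move=> n; have [p lp ep] := af n.
exists (push p); first exact: free_lie_push.
by move=> w le; apply: eq_bigr => u _; apply: ep; rewrite size_tuple.
Qed.

Definition hatL_map (x : hatL V) : hatL W :=
  mk_hatL (in_hatL_push (hatL_in x)).

Lemma hatL_map_gen v : hatL_map (hatL_gen v) = hatL_gen (h v).
Proof. by apply: hatL_inj; apply: push_letter. Qed.

End Pushforward.

(* [bernoulli_seq n] lists the Bernoulli numbers B_0, .., B_n, with
   B_1 = - 1/2. *)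
Fixpoint bernoulli_seq (n : nat) : seq rat :=
  if n is m.+1 then
    let s := bernoulli_seq m in
    rcons s (- (\sum_(k < m.+1) 'C(m.+2, k)%:R * s`_k) / m.+2%:R)
  else [:: 1].

Definition bernoulli (n : nat) : rat := (bernoulli_seq n)`_n.

Lemma size_bernoulli_seq n : size (bernoulli_seq n) = n.+1.
Proof. by elim: n => //= n IH; rewrite size_rcons IH. Qed.

Lemma nth_bernoulli_seq n k : (k <= n)%N -> (bernoulli_seq n)`_k = bernoulli k.
Proof.
elim: n => [|n IH]; first by rewrite leqn0 => /eqP ->.
rewrite leq_eqVlt => /orP[/eqP -> //|lt].
by rewrite /= nth_rcons size_bernoulli_seq lt IH.
Qed.

Lemma bernoulli_rec n :
  \sum_(k < n.+2) 'C(n.+2, k)%:R * bernoulli k = 0.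
Proof.
rewrite big_ord_recr /= binSn.
rewrite /bernoulli /= nth_rcons size_bernoulli_seq ltnn eqxx.
rewrite mulrC divfK ?pnatr_eq0 // addrC; apply/eqP; rewrite addr_eq0 eqr_opp.
apply/eqP; apply: eq_bigr => k _; congr (_ * _).
by apply: nth_bernoulli_seq; rewrite -ltnS.
Qed.

Definition LS_interval (V : gradedSet) (D : hatL V -> hatL V)
    (a b x : hatL V) : Prop :=
  [/\ maurer_cartan D a, maurer_cartan D b &
      coefs (D x) = coefs (bracket x b)
        + ssum (fun n => (bernoulli n / n`!%:R) *:
                           coefs (iter n (bracket x) (b - a)))].

(* The generator a_{i_0 .. i_p}, with i_0 < .. < i_p, is indexed by the
   nonempty set {i_0, .., i_p}. *)
Definition face (n : nat) := {A : {set 'I_n.+1} | A != set0}.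

Definition face_deg n (A : face n) : int := #|val A|%:Z - 2%:Z.

Definition simplex (n : nat) : gradedSet := GradedSet (@face_deg n).

(* The convention a_{emptyset} = 0 makes the formula for the linear part of the
   differential uniform: its sum vanishes on vertices. *)
Definition agen n (A : {set 'I_n.+1}) : hatL (simplex n) :=
  if insub A is Some s then hatL_gen (s : simplex n) else 0.

Fact lift_face_proof n (i : 'I_n.+2) (A : face n) : lift i @: val A != set0.
Proof. by rewrite imset_eq0 (valP A). Qed.

Definition lift_face n (i : 'I_n.+2) (A : face n) : face n.+1 :=
  Sub (lift i @: val A) (lift_face_proof i A).

Fact lift_face_deg n (i : 'I_n.+2) (A : simplex n) :
  gdeg (lift_face i A : simplex n.+1) = gdeg A.
Proof. by rewrite /= /face_deg /= card_imset //; apply: lift_inj. Qed.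

(* Induced by [lift i], the order preserving injection missing i. *)
Definition coface n (i : 'I_n.+2) : hatL (simplex n) -> hatL (simplex n.+1) :=
  hatL_map (lift_face_deg i).

Lemma coface_agen n (i : 'I_n.+2) (A : {set 'I_n.+1}) :
  coface i (agen A) = agen (lift i @: A).
Proof.
rewrite /agen; case: insubP => [s _ <-|].
  rewrite /coface hatL_map_gen insubT ?lift_face_proof // => H.
  by congr hatL_gen; apply: val_inj.
rewrite negbK => /eqP ->; rewrite imset0 insubF ?eqxx //.
by apply: hatL_inj; apply: push0.
Qed.

Definition linear_part (V : gradedSet) (f : series V) : series V :=
  fun w => if size w == 1%N then f w else 0.

Definition has_simplicial_linear_part n
    (D : hatL (simplex n) -> hatL (simplex n)) : Prop :=
  forall A : {set 'I_n.+1},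
    linear_part (coefs (D (agen A))) =
      coefs (\sum_(i in A) (-1) ^+ #|[set k in A | (k < i)%N]|
                              *: agen (A :\ i)).

Definition is_triangle_model (D : hatL (simplex 2) -> hatL (simplex 2)) : Prop :=
  [/\ is_differential D,
      forall i : 'I_3, maurer_cartan D (agen [set i]),
      has_simplicial_linear_part D &
      exists D1 : hatL (simplex 1) -> hatL (simplex 1),
        [/\ is_differential D1,
            LS_interval D1 (agen [set ord0]) (agen [set ord_max]) (agen setT) &
            forall i : 'I_3, dgl_morphism D1 D (coface i)]].

Definition o0 : 'I_3 := @Ordinal 3 0 isT.
Definition o1 : 'I_3 := @Ordinal 3 1 isT.
Definition o2 : 'I_3 := @Ordinal 3 2 isT.

Definition a0 : hatL (simplex 2) := agen [set o0].
Definition a1 : hatL (simplex 2) := agen [set o1].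
Definition a2 : hatL (simplex 2) := agen [set o2].
Definition a01 : hatL (simplex 2) := agen [set o0; o1].
Definition a12 : hatL (simplex 2) := agen [set o1; o2].
Definition a02 : hatL (simplex 2) := agen [set o0; o2].
Definition a012 : hatL (simplex 2) := agen [set o0; o1; o2].

(* The identity on a012 is one of noncommutative power series; as its left-hand
   side is in the image of [coefs], it contains the fact that the product is a
   Lie series. *)
Definition triangle_derivation (D : hatL (simplex 2) -> hatL (simplex 2)) :
    Prop :=
  [/\ is_derivation D,
      LS_interval D a0 a1 a01,
      LS_interval D a1 a2 a12,
      LS_interval D a0 a2 a02 &
      coefs (twist D a0 a012) =
        bch (bch (coefs a01) (coefs a12)) (- coefs a02)].

(* Main.v *)
Require Import Defs.
From mathcomp Require Import all_boot all_order all_algebra.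
From mathcomp Require Import boolp.
From mathcomp Require Import ring lra zify.

Set Implicit Arguments.
Unset Strict Implicit.
Unset Printing Implicit Defensive.

Import Order.TTheory GRing.Theory Num.Theory.
Local Open Scope ring_scope.

(** The proof takes place in the completed tensor algebra T of all series in the
    generators, where exponentials make sense and where bch f g is by definition
    the logarithm of e^f e^g.

    The tool is the derivative of an exponential [derivation_exp]: for a
    continuous derivation E and z of degree 0,
      E (e^z) = (sum over k of ad_z^k (E z) / (k+1)!) e^z.
    The operator in front is (e^{ad_z} - 1) / ad_z, and the recursion defining
    the Bernoulli numbers says that its inverse is the series ad_z / (e^{ad_z} - 1)
    of the Lawrence-Sullivan differential.  Hence the
    formula for D x, when x is an interval from a to b, is the gauge equation
      D (e^x) = e^x b - a e^x    [sder_exp_interval].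

    Everything follows from this form.  Applying D again and using D a = - a^2,
    D b = - b^2 gives D (D (e^x)) = 0, hence D (D x) = 0 because D o D is itself
    a derivation [sder_sq_interval].  Going around the triangle, the terms in the
    vertices telescope: for z = a01 * a12 * a02^{-1} one gets
    D (e^z) = e^z a0 - a0 e^z, so the derivation D + ad_{a0} kills e^z and
    therefore z [sder_bch_triangle].  With D a012 = z - [a0, a012] this is
    exactly D (D a012) = 0 [sder_sq_triangle].

    The same formula shows that the differential takes its values in Lie series.
    If y is a letter not occurring in g and z = bch y g, the derivation E counting
    the occurrences of y satisfies E (e^z) = y e^z, so E z is the Bernoulli
    series of ad_z applied to y.  The part of E z of length n + 1 depends on z
    only up to length n, and z is recovered from E z and its part g without y, so
    z is a Lie series by induction on the length [in_hatL_bch_letter].  The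
    product around the triangle is of this kind, a01 and then a12 playing the
    role of y.

    The derivation itself is the extension to T of its values on the letters
    [sder]; it maps Lie series to Lie series since it does so on bracket
    monomials.  Uniqueness is less formal, for a derivation of the completed free
    Lie algebra is not assumed to be continuous: one writes every element as a
    combination of generators plus a finite sum of brackets [v, y_v] with v a
    generator and y_v an infinite series [in_hatL_ad_letters].  A derivation that
    vanishes on the generators therefore raises the order of its values
    indefinitely, and so is zero [hatL_gens_determine]. *)

(** * The filtration of series by word length *)

Section Order.
Variable V : gradedSet.
Implicit Types (f g h : series V) (F G : nat -> series V).

Lemma saddE f g w : (f + g) w = f w + g w. Proof. by []. Qed.
Lemma soppE f w : (- f) w = - f w. Proof. by []. Qed.
Lemma sscaleE (c : rat) f w : (c *: f) w = c * f w. Proof. by []. Qed.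
Lemma szeroE w : (0 : series V) w = 0. Proof. by []. Qed.
Lemma soneE w : (1 : series V) w = (w == [::])%:R. Proof. by []. Qed.
Lemma smulE f g w :
  (f * g) w = \sum_(i < (size w).+1) f (take i w) * g (drop i w).
Proof. by []. Qed.

Definition seriesE := (saddE, soppE, sscaleE, szeroE).

(** T is complete for this filtration, and [ssum] is convergence for it. *)
Definition ord_ge n f := forall w, (size w < n)%N -> f w = 0.

Lemma ord_ge0 f : ord_ge 0 f. Proof. by []. Qed.

Lemma ord_ge_zero n : ord_ge n 0. Proof. by []. Qed.

Lemma ord_geW m n f : (m <= n)%N -> ord_ge n f -> ord_ge m f.
Proof. by move=> le hf w lt; apply: hf; apply: leq_trans lt le. Qed.

Lemma ord_geZ n (c : rat) f : ord_ge n f -> ord_ge n (c *: f).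
Proof. by move=> hf w lt; rewrite seriesE hf ?mulr0. Qed.

Lemma ord_geD n f g : ord_ge n f -> ord_ge n g -> ord_ge n (f + g).
Proof. by move=> hf hg w lt; rewrite seriesE hf ?hg ?addr0. Qed.

Lemma ord_geN n f : ord_ge n f -> ord_ge n (- f).
Proof. by move=> hf w lt; rewrite seriesE hf ?oppr0. Qed.

Lemma ord_geB n f g : ord_ge n f -> ord_ge n g -> ord_ge n (f - g).
Proof. by move=> hf hg; apply/ord_geD/ord_geN. Qed.

Lemma ord_ge_sum n I (r : seq I) (P : pred I) (F : I -> series V) :
  (forall i, P i -> ord_ge n (F i)) -> ord_ge n (\sum_(i <- r | P i) F i).
Proof. by move=> hF; elim/big_ind: _ => //; apply: ord_geD. Qed.

Lemma ord_geM m n f g : ord_ge m f -> ord_ge n g -> ord_ge (m + n) (f * g).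
Proof.
move=> hf hg w lt; rewrite smulE big1 // => i _.
have [ltm|lem] := ltnP (size (take i w)) m; first by rewrite hf ?mul0r.
rewrite hg ?mulr0 //; move: lem lt; have := ltn_ord i.
by rewrite size_take size_drop; case: ifP; lia.
Qed.

Lemma ord_geX n f : ord_ge 1 f -> ord_ge n (f ^+ n).
Proof.
move=> hf; elim: n => [|n IH]; first exact: ord_ge0.
by rewrite exprS -add1n; apply: ord_geM.
Qed.

Lemma ord_ge_eq0 f : (forall n, ord_ge n f) -> f = 0.
Proof. by move=> hf; apply/funext => w; apply: (hf (size w).+1). Qed.

Lemma ord_ge1 f : f [::] = 0 -> ord_ge 1 f.
Proof. by move=> f0 [|x w]. Qed.

Lemma ord_ge_letter x : ord_ge 1 (letter x : series V).
Proof. exact: ord_ge1. Qed.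

Definition summable F := forall n, ord_ge n (F n).

Lemma ssumE F N w : summable F -> (size w < N)%N ->
  ssum F w = \sum_(n < N) F n w.
Proof. by move=> hF lt; rewrite -(ssum_limit hF lt) series_sumE. Qed.

Lemma eq_ssum F G : F =1 G -> ssum F = ssum G.
Proof. by move=> /funext ->. Qed.

Lemma ssumD F G : ssum (fun n => F n + G n) = ssum F + ssum G.
Proof. by apply/funext => w; rewrite seriesE /ssum -big_split. Qed.

Lemma ssumZ (c : rat) F : ssum (fun n => c *: F n) = c *: ssum F.
Proof. by apply/funext => w; rewrite seriesE /ssum mulr_sumr. Qed.

Lemma ord_ge_ssum n F : (forall k, ord_ge n (F k)) -> ord_ge n (ssum F).
Proof. by move=> hF w lt; rewrite /ssum big1 // => i _; apply: hF. Qed.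

Lemma ssum_head F : (forall n, F n.+1 = 0) -> ssum F = F 0%N.
Proof.
move=> F0; apply/funext => w; rewrite /ssum big_ord_recl big1 ?addr0 // => i _.
by rewrite F0.
Qed.

Lemma ssum_recl F : summable F -> ssum F = F 0%N + ssum (fun n => F n.+1).
Proof.
move=> hF; apply/funext => w; rewrite seriesE (@ssumE _ (size w).+2) //.
by rewrite big_ord_recl.
Qed.

Lemma ssum_tail F N : summable F -> ord_ge N (ssum F - \sum_(n < N) F n).
Proof.
by move=> hF w lt; rewrite !seriesE (ssumE hF lt) series_sumE subrr.
Qed.

(** The terms with N <= a + b being zero, the square can be replaced by the
    triangle, which is then summed along its antidiagonals. *)
Lemma sum_triangle (G : nat -> nat -> rat) N :
  (forall a b, (N <= a + b)%N -> G a b = 0) ->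
  \sum_(a < N) \sum_(b < N) G a b =
  \sum_(n < N) \sum_(i < n.+1) G i (n - i)%N.
Proof.
move=> G0.
have -> : \sum_(n < N) \sum_(i < n.+1) G i (n - i)%N =
   \sum_(n < N) \sum_(i < N | (i < n.+1)%N) G i (n - i)%N.
  by apply: eq_bigr => n _; rewrite (big_ord_widen N (fun i => G i (n - i)%N)).
rewrite [RHS](exchange_big_dep xpredT) //=; apply: eq_bigr => a _.
have la := ltn_ord a; pose M := (N - a)%N.
have eN : N = (a + M)%N by rewrite /M; lia.
transitivity (\sum_(0 <= n < N | (a <= n)%N) G a (n - a)%N); last first.
  by rewrite big_mkord; apply: eq_bigl => n; rewrite ltnS.
rewrite big_mkcond /=; symmetry.
rewrite (@big_cat_nat _ _ _ a) //=; last by lia.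
have -> : \sum_(0 <= i < a | (a <= i)%N) G a (i - a)%N = 0.
  by rewrite big_nat_cond big1 // => i; lia.
rewrite add0r.
have := big_addn 0 N a (fun n => (a <= n)%N) (fun n => G a (n - a)%N).
rewrite add0n -/M => ->.
have leM : (M <= N)%N by lia.
rewrite -(big_mkord xpredT (G a)) (big_cat_nat (leq0n M) leM) /=.
have -> : \sum_(M <= i < N) G a i = 0.
  by rewrite big_nat_cond big1 // => i hi; apply: G0; lia.
rewrite addr0.
by apply: eq_big => [i|i _]; rewrite ?leq_addl ?addnK.
Qed.

Lemma ssum_double (F : nat -> nat -> series V) :
  (forall a b, ord_ge (a + b) (F a b)) ->
  ssum (fun a => ssum (F a)) = ssum (fun n => \sum_(i < n.+1) F i (n - i)%N).
Proof.
move=> hF; apply/funext => w; rewrite /ssum.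
rewrite (sum_triangle (G := fun a b => F a b w)).
  by apply: eq_bigr => n _; rewrite series_sumE.
by move=> a b le; apply: (hF a b).
Qed.

End Order.

(** Continuity for word length, in the strong form that the length never
    decreases: such maps commute with [ssum]. *)
Record ord_linear (V W : gradedSet) (T : series V -> series W) : Prop :=
  OrdLinear {
    ord_linP : forall (c : rat) f g, T (c *: f + g) = c *: T f + T g;
    ord_lin_ge : forall n f, ord_ge n f -> ord_ge n (T f)
  }.

Section OrdLinear.
Variables (V W : gradedSet) (T : series V -> series W).
Hypothesis hT : ord_linear T.

Lemma ord_lin0 : T 0 = 0.
Proof.
have := ord_linP hT 1 0 0; rewrite !scale1r addr0 => e.
by apply: (addrI (T 0)); rewrite -e addr0.
Qed.

Lemma ord_linD f g : T (f + g) = T f + T g.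
Proof. by rewrite -[f]scale1r (ord_linP hT) !scale1r. Qed.

Lemma ord_linZ (c : rat) f : T (c *: f) = c *: T f.
Proof. by rewrite -[c *: f]addr0 (ord_linP hT) ord_lin0 addr0. Qed.

Lemma ord_linN f : T (- f) = - T f.
Proof. by rewrite -scaleN1r ord_linZ scaleN1r. Qed.

Lemma ord_linB f g : T (f - g) = T f - T g.
Proof. by rewrite ord_linD ord_linN. Qed.

Lemma ord_lin_sum I (r : seq I) (P : pred I) (F : I -> series V) :
  T (\sum_(i <- r | P i) F i) = \sum_(i <- r | P i) T (F i).
Proof. exact: (big_morph T ord_linD ord_lin0). Qed.

Lemma ord_lin_ssum (F : nat -> series V) : summable F ->
  T (ssum F) = ssum (fun n => T (F n)).
Proof.
move=> hF; apply/funext => w; pose N := (size w).+1.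
rewrite (@ssumE _ _ N) //; last by move=> n; apply: (ord_lin_ge hT); apply: hF.
have := ord_lin_ge hT (@ssum_tail _ _ N hF) (leqnn _).
rewrite ord_linB ord_lin_sum !seriesE series_sumE => /eqP.
by rewrite subr_eq0 => /eqP.
Qed.

End OrdLinear.

Section ExpBasics.
Variable V : gradedSet.
Implicit Types (f g h z c : series V) (F G : nat -> series V).

Lemma ord_linear_mull f : ord_linear (fun g => f * g).
Proof.
split=> [c g h|n g hg]; first by rewrite mulrDr scalerAr.
by rewrite -[n]add0n; apply: ord_geM.
Qed.

Lemma ord_linear_mulr f : ord_linear (fun g => g * f).
Proof.
split=> [c g h|n g hg]; first by rewrite mulrDl scalerAl.
by rewrite -[n]addn0; apply: ord_geM.
Qed.

Lemma ssumM F G : summable F -> summable G ->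
  ssum F * ssum G = ssum (fun n => \sum_(i < n.+1) F i * G (n - i)%N).
Proof.
move=> hF hG; rewrite (ord_lin_ssum (ord_linear_mulr _) hF).
rewrite -(ssum_double (F := fun a b => F a * G b)) => [|a b]; last exact: ord_geM.
by apply: eq_ssum => a; rewrite (ord_lin_ssum (ord_linear_mull _) hG).
Qed.

Lemma summable_exp f : ord_ge 1 f -> summable (fun n => (n`!%:R)^-1 *: f ^+ n).
Proof. by move=> hf n; apply/ord_geZ/ord_geX. Qed.

Lemma sexpD f g : ord_ge 1 f -> ord_ge 1 g -> GRing.comm f g ->
  sexp f * sexp g = sexp (f + g).
Proof.
move=> hf hg cfg.
rewrite [LHS]ssumM; [|exact: summable_exp..]; apply: eq_ssum => n.
rewrite addrC exprDn_comm; last exact: commr_sym.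
rewrite scaler_sumr; apply: eq_bigr => i _.
have le : (i <= n)%N by rewrite -ltnS.
rewrite -scalerAl -scalerAr scalerA -(commrX _ (commr_sym (commrX _ (commr_sym cfg)))).
rewrite -scaler_nat scalerA; congr (_ *: _).
rewrite -(bin_fact le) !natrM.
by field; rewrite !pnatr_eq0 -!lt0n !fact_gt0 bin_gt0 le.
Qed.

Lemma sexp0 : sexp 0 = 1 :> series V.
Proof.
rewrite [LHS]ssum_head => [|n]; last by rewrite exprS mul0r scaler0.
by rewrite expr0 fact0 invr1 scale1r.
Qed.

Lemma sexpN f : ord_ge 1 f -> sexp f * sexp (- f) = 1.
Proof.
move=> hf; rewrite sexpD ?subrr ?sexp0 //; first exact: ord_geN.
by apply: commrN.
Qed.

Lemma sexpNr f : ord_ge 1 f -> sexp (- f) * sexp f = 1.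
Proof. by move=> hf; rewrite -{2}[f]opprK; apply/sexpN/ord_geN. Qed.

Lemma sexp_nil f : sexp f [::] = 1.
Proof. by rewrite /sexp /ssum big_ord1 expr0 fact0 invr1 scale1r soneE. Qed.

End ExpBasics.

(** * Exponential, logarithm and the Bernoulli series *)

(** The commutator of T. It is the graded bracket as soon as f has degree 0,
    which is the only case where it is iterated. *)
Definition ad (V : gradedSet) (f g : series V) : series V := f * g - g * f.

Section AdSeries.
Variable V : gradedSet.
Implicit Types (f g h z c : series V) (a b : nat -> rat).

Lemma adP f (c : rat) g h : ad f (c *: g + h) = c *: ad f g + ad f h.
Proof.
by rewrite /ad mulrDr mulrDl -scalerAl -scalerAr scalerBr opprD addrACA.
Qed.

Lemma ord_ge_ad m n f g : ord_ge m f -> ord_ge n g -> ord_ge (m + n) (ad f g).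
Proof.
by move=> hf hg; apply: ord_geB; [|rewrite addnC]; apply: ord_geM.
Qed.

Lemma ord_linear_ad f : ord_linear (ad f).
Proof.
split=> [c g h|n g hg]; first exact: adP.
by rewrite -[n]add0n; apply: ord_ge_ad.
Qed.

Lemma ord_linear_iter_ad f n : ord_linear (iter n (ad f)).
Proof.
elim: n => [|n IH]; first by split.
have hc := ord_linear_ad f.
split=> [c g h|m g hg]; rewrite !iterS.
  by rewrite (ord_linP IH) (ord_linP hc).
exact/(ord_lin_ge hc)/(ord_lin_ge IH).
Qed.

Lemma ord_ge_iter_ad n m f g :
  ord_ge 1 f -> ord_ge m g -> ord_ge (n + m) (iter n (ad f) g).
Proof.
move=> hf hg; elim: n => [|n IH] //=.
by rewrite -add1n -addnA; apply: ord_ge_ad.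
Qed.

(** The operator a(ad_z), where a is read as a power series: composing such
    operators multiplies the power series, so that an inverse can be found on
    the coefficients. *)
Definition adser z a c : series V := ssum (fun n => a n *: iter n (ad z) c).

Lemma summable_adser z a c : ord_ge 1 z ->
  summable (fun n => a n *: iter n (ad z) c).
Proof.
move=> hz n; apply: ord_geZ.
by have := ord_ge_iter_ad (n := n) hz (ord_ge0 c); rewrite addn0.
Qed.

Lemma adser_comp z a b c : ord_ge 1 z ->
  adser z a (adser z b c) = adser z (fun n => \sum_(i < n.+1) a i * b (n - i)%N) c.
Proof.
move=> hz; rewrite {1}/adser.
have -> : (fun n => a n *: iter n (ad z) (adser z b c)) =
  fun n => ssum (fun m => (a n * b m) *: iter (n + m) (ad z) c).
  apply/funext => n; have hl := ord_linear_iter_ad z n.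
  rewrite (ord_lin_ssum hl); last exact: summable_adser.
  rewrite -ssumZ; apply: eq_ssum => m.
  by rewrite (ord_linZ hl) scalerA iterD.
rewrite (ssum_double (F := fun n m => (a n * b m) *: iter (n + m) (ad z) c)).
  apply: eq_ssum => n; rewrite scaler_suml; apply: eq_bigr => i _.
  by rewrite subnKC // -ltnS.
move=> n m; apply: ord_geZ.
by have := ord_ge_iter_ad (n := n + m) hz (ord_ge0 c); rewrite addn0.
Qed.

Lemma adser_delta z c : adser z (fun n => (n == 0)%:R) c = c.
Proof.
by rewrite /adser ssum_head ?scale1r // => n; rewrite scale0r.
Qed.

(** The coefficients of (e^t - 1) / t. *)
Definition expc (n : nat) : rat := (n.+1`!%:R)^-1.
(** The coefficients of t / (e^t - 1). *)
Definition todd (n : nat) : rat := bernoulli n / n`!%:R.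

Lemma bin_fact_inv n k : (k <= n)%N ->
  'C(n, k)%:R / n`!%:R = (k`!%:R)^-1 * ((n - k)`!%:R)^-1 :> rat.
Proof.
move=> le; rewrite -(bin_fact le) natrM natrM.
by field; rewrite !pnatr_eq0 -!lt0n !fact_gt0 bin_gt0 le.
Qed.

(** Multiplied by (n + 1)!, this is the recursion of the Bernoulli numbers. *)
Lemma todd_expc n : \sum_(i < n.+1) todd i * expc (n - i) = (n == 0)%:R.
Proof.
case: n => [|n].
  by rewrite big_ord1 /todd /expc /bernoulli /= !fact0 invr1 !mulr1.
have := bernoulli_rec n; move/(congr1 (fun x => x / n.+2`!%:R)).
rewrite mul0r mulr_suml => e; rewrite -[RHS]e; apply: eq_bigr => i _.
have le : (i <= n.+2)%N by apply: ltnW; apply: leq_trans (ltn_ord i) _.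
have le' : (n.+1 - i).+1 = (n.+2 - i)%N by have := ltn_ord i; lia.
by rewrite /todd /expc le' [RHS]mulrAC bin_fact_inv // [RHS]mulrC mulrA.
Qed.

Lemma expc_todd n : \sum_(i < n.+1) expc i * todd (n - i) = (n == 0)%:R.
Proof.
rewrite -todd_expc (reindex_inj rev_ord_inj) /=; apply: eq_bigr => i _.
by rewrite mulrC subSS subKn // -ltnS.
Qed.

Lemma adser_expc_todd z c : ord_ge 1 z -> adser z expc (adser z todd c) = c.
Proof.
move=> hz; rewrite adser_comp // -[RHS](adser_delta z).
by congr adser; apply/funext => n; apply: expc_todd.
Qed.

Lemma adser_todd_expc z c : ord_ge 1 z -> adser z todd (adser z expc c) = c.
Proof.
move=> hz; rewrite adser_comp // -[RHS](adser_delta z).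
by congr adser; apply/funext => n; apply: todd_expc.
Qed.

Lemma ord_linear_adser z a : ord_linear (adser z a).
Proof.
have hl n := ord_linear_iter_ad z n; split=> [c f g|n f hf].
  rewrite /adser -ssumZ -ssumD; apply: eq_ssum => n.
  by rewrite (ord_linP (hl n)) scalerDr !scalerA mulrC.
by apply: ord_ge_ssum => k; apply/ord_geZ/(ord_lin_ge (hl k)).
Qed.

(** Left multiplication by z is the sum of ad_z and of right multiplication by
    z, which commute: the binomial theorem applies. *)
Lemma mulX_ad z c n : z ^+ n * c =
  \sum_(k < n.+1) 'C(n, k)%:R *: (iter k (ad z) c * z ^+ (n - k)).
Proof.
elim: n => [|n IH]; first by rewrite big_ord1 bin0 scale1r mul1r mulr1.
rewrite exprS -mulrA IH mulr_sumr.
have step k : (k < n.+1)%N -> z * ('C(n, k)%:R *: (iter k (ad z) c * z ^+ (n - k))) =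
  'C(n, k)%:R *: (iter k.+1 (ad z) c * z ^+ (n.+1 - k.+1))
  + 'C(n, k)%:R *: (iter k (ad z) c * z ^+ (n.+1 - k)).
  move=> lt; rewrite -scalerDr -scalerAr; congr (_ *: _).
  rewrite subSS subSn // exprS [in RHS]mulrA -mulrDl mulrA; congr (_ * _).
  by rewrite iterS /ad subrK.
rewrite (eq_bigr _ (fun (k : 'I_n.+1) _ => step k (ltn_ord k))) big_split /=.
rewrite [RHS]big_ord_recl [X in _ + X]big_ord_recl !bin0.
rewrite addrCA; congr (_ + _).
rewrite [RHS](eq_bigr (fun i : 'I_n.+1 =>
  'C(n, i)%:R *: (iter i.+1 (ad z) c * z ^+ (n.+1 - i.+1))
  + 'C(n, i.+1)%:R *: (iter i.+1 (ad z) c * z ^+ (n.+1 - i.+1)))); last first.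
  by move=> i _; rewrite lift0 binS natrD scalerDl addrC.
rewrite big_split; congr (_ + _).
by rewrite big_ord_recr /= bin_small // scale0r addr0.
Qed.

Section Derivation.
Variables (E : series V -> series V) (z : series V).
Hypothesis hE : ord_linear E.
Hypothesis E1 : E 1 = 0.
Hypothesis EX : forall n, E (z ^+ n * z) = E (z ^+ n) * z + z ^+ n * E z.

Lemma derivationX n : E (z ^+ n) =
  \sum_(k < n) 'C(n, k.+1)%:R *: (iter k (ad z) (E z) * z ^+ (n - k.+1)).
Proof.
elim: n => [|n IH]; first by rewrite expr0 E1 big_ord0.
rewrite exprSr EX IH mulX_ad mulr_suml.
rewrite [RHS](eq_bigr (fun k : 'I_n.+1 =>
  'C(n, k.+1)%:R *: (iter k (ad z) (E z) * z ^+ (n - k))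
  + 'C(n, k)%:R *: (iter k (ad z) (E z) * z ^+ (n - k)))); last first.
  by move=> i _; rewrite binS natrD scalerDl subSS.
rewrite big_split; congr (_ + _).
rewrite big_ord_recr /= bin_small // scale0r addr0; apply: eq_bigr => k _.
by rewrite -scalerAl -mulrA -exprSr; congr (_ *: (_ * _ ^+ _)); have := ltn_ord k; lia.
Qed.

(** Only the Leibniz rule on powers of z has been assumed of E. This covers odd
    derivations (z has degree 0), their squares, and commutators with any
    element. *)
Lemma derivation_exp : ord_ge 1 z -> E (sexp z) = adser z expc (E z) * sexp z.
Proof.
move=> hz; rewrite /sexp (ord_lin_ssum hE); last exact: summable_exp.
rewrite ssumM; [|exact: summable_adser|exact: summable_exp].
rewrite ssum_recl => [|n]; last first.
  by apply: (ord_lin_ge hE); apply: summable_exp.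
rewrite expr0 (ord_linZ hE) E1 scaler0 add0r; apply: eq_ssum => n.
rewrite (ord_linZ hE) derivationX scaler_sumr; apply: eq_bigr => k _.
have le : (k.+1 <= n.+1)%N by apply: ltn_ord.
rewrite -scalerAl -scalerAr !scalerA subSS; congr (_ *: _).
by rewrite mulrC bin_fact_inv // subSS.
Qed.

(** The operator of [derivation_exp] is inverted by the Bernoulli series, so the
    logarithmic derivative of e^z determines E z. *)
Lemma derivation_log c : ord_ge 1 z -> E (sexp z) = c * sexp z ->
  E z = adser z todd c.
Proof.
move=> hz; rewrite derivation_exp // => /(congr1 (fun f => f * sexp (- z))).
rewrite -!mulrA sexpN // !mulr1 => <-.
by rewrite adser_todd_expc.
Qed.

End Derivation.
End AdSeries.

Section ExpLog.
Variable V : gradedSet.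
Implicit Types (f g h z c u v : series V).

Lemma ord_geXB m n f g : ord_ge 1 f -> ord_ge 1 g -> ord_ge m (f - g) ->
  ord_ge (n + m) (f ^+ n.+1 - g ^+ n.+1).
Proof.
move=> hf hg hfg; elim: n => [|n IH] //.
have -> : f ^+ n.+2 - g ^+ n.+2 = f * (f ^+ n.+1 - g ^+ n.+1) + (f - g) * g ^+ n.+1.
  by rewrite mulrBr mulrBl -!exprS addrA subrK.
apply: ord_geD; first by rewrite -add1n -addnA; apply: ord_geM.
by rewrite addnC; apply: ord_geM => //; apply: ord_geX.
Qed.

(** If f and g agree up to length n, the terms of degree at least 2 of their
    exponentials agree up to length n + 1, so that f and g do as well. *)
Lemma sexp_inj f g : ord_ge 1 f -> ord_ge 1 g -> sexp f = sexp g -> f = g.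
Proof.
move=> hf hg e; apply/eqP; rewrite -subr_eq0; apply/eqP/ord_ge_eq0.
elim=> [|n IH]; first exact: ord_ge0.
have s1 := summable_exp hf; have s2 := summable_exp hg.
have : sexp f - sexp g = 0 by rewrite e subrr.
rewrite /sexp (ssum_recl s1) (ssum_recl s2) !expr0 opprD addrACA subrr add0r.
rewrite -scaleN1r -ssumZ -ssumD => e1 w lt.
have := congr1 (fun s : series V => s w) e1; rewrite /ssum big_ord_recl big1 ?addr0.
  by rewrite !expr1 invr1 !scale1r scaleN1r szeroE.
move=> i _; rewrite lift0 /= scalerA mulN1r scaleNr -scalerBr.
by apply: (ord_geZ _ (ord_geXB hf hg IH)); lia.
Qed.

(** [exp_poly] and [log_poly] are truncations of e^t and log (1 + t). *)
Definition exp_poly N : {poly rat} := \poly_(i < N.+1) (i`!%:R)^-1.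
Definition log_poly N : {poly rat} :=
  \sum_(k < N) ((-1) ^+ k / k.+1%:R) *: 'X^(k.+1).

Lemma deriv_exp_poly N : (exp_poly N.+1)^`() = exp_poly N.
Proof.
apply/polyP => i; rewrite coef_deriv !coef_poly ltnS; case: ifP => // _; last by rewrite mul0rn.
by rewrite -[LHS]mulr_natr factS natrM invfM mulrAC mulVf ?mul1r // pnatr_eq0.
Qed.

Lemma deriv_log_poly N : (1 + 'X) * (log_poly N)^`() = 1 - (-'X) ^+ N.
Proof.
elim: N => [|N IH]; first by rewrite /log_poly big_ord0 deriv0 mulr0 expr0 subrr.
rewrite /log_poly big_ord_recr derivD mulrDr IH derivZ derivXn /=.
rewrite -scaler_nat scalerA.
have -> : (-1) ^+ N / N.+1%:R * N.+1%:R = (-1) ^+ N :> rat.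
  by rewrite divfK // pnatr_eq0.
rewrite -exprZn scaleN1r exprS; ring.
Qed.

(** P = exp o log satisfies (1 + X) P' = P up to the truncation. Comparing
    coefficients, this is a recursion of order one, solved by 1 + X. *)
Lemma coef_exp_log N k : (k <= N)%N -> (exp_poly N \Po log_poly N)`_k = (1 + 'X)`_k.
Proof.
case: N => [|N].
  rewrite leqn0 => /eqP ->; rewrite /log_poly big_ord0 comp_poly0r coef_poly.
  by rewrite coefC coefD coef1 coefX fact0 invr1 addr0.
set L := log_poly N.+1; set P : {poly rat} := _ \Po L.
have [M eL] : exists M, L = M * 'X.
  exists (\sum_(k < N.+1) ((-1) ^+ k / k.+1%:R) *: 'X^k).
  by rewrite mulr_suml; apply: eq_bigr => i _; rewrite -scalerAl exprSr.
have P0 : P`_0 = 1.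
  rewrite -horner_coef0 /P horner_comp eL hornerM hornerX mulr0 horner_coef0.
  by rewrite coef_poly /= fact0 invr1.
have step i : (i <= N)%N -> (P`_i.+1 *+ i.+1) = P`_i - P`_i *+ i.
  move=> le; have : ((1 + 'X) * P^`())`_i = P`_i.
    rewrite /P deriv_comp deriv_exp_poly mulrCA deriv_log_poly mulrBr mulr1.
    have -> : exp_poly N.+1 = exp_poly N + (N.+1`!%:R)^-1 *: 'X^(N.+1).
      rewrite /exp_poly !poly_def big_ord_recr /=; congr (_ + _).
    rewrite comp_polyD comp_polyZ comp_Xn_poly eL exprMn exprNn !mulrA.
    by rewrite coefB coefD coefZ !coefMXn !ltnS le subr0 mulr0 addr0.
  rewrite mulrDl mul1r coefD ['X * _]mulrC coefMX coef_deriv => e; rewrite -{1}e {e}.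
  case: i {le} => [|i] /=; rewrite ?addr0 ?mulr0n ?subr0 ?coef_deriv ?addrK //.
elim: k => [|k IH] le; first by rewrite P0 coefD coef1 coefX addr0.
have := step k le; rewrite IH ?(ltnW le) // -mulr_natr => e.
have nz : k.+1%:R != 0 :> rat by rewrite pnatr_eq0.
apply: (mulIf nz); rewrite {}e !coefD !coef1 !coefX.
by case: k {IH le nz} => [|[|k]] /=; rewrite ?add0r ?addr0 ?mul0rn ?subr0 ?mulr1 ?mul0r ?subrr.
Qed.

Lemma horner_algZXn f (c : rat) i : horner_alg f (c *: 'X^i) = c *: f ^+ i.
Proof. by rewrite linearZ /= rmorphXn /= horner_algX mulr_algl. Qed.

Lemma horner_alg_coef f (p : {poly rat}) :
  horner_alg f p = \sum_(i < size p) p`_i *: f ^+ i.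
Proof.
rewrite -{1}[p]coefK poly_def linear_sum; apply: eq_bigr => i _.
exact: horner_algZXn.
Qed.

Lemma horner_alg_comp f (p q : {poly rat}) :
  horner_alg f (p \Po q) = horner_alg (horner_alg f q) p.
Proof.
elim/poly_ind: p => [|p c IH]; first by rewrite comp_poly0 !rmorph0.
rewrite comp_poly_MXaddC !rmorphD !rmorphM /= IH.
by rewrite !horner_algC horner_algX.
Qed.

Lemma ord_ge_horner N f (p : {poly rat}) : ord_ge 1 f ->
  (forall i, (i < N)%N -> p`_i = 0) -> ord_ge N (horner_alg f p).
Proof.
move=> hf hp; rewrite horner_alg_coef; apply: ord_ge_sum => i _.
have [/hp ->|le] := ltnP i N; first by rewrite scale0r; apply: ord_ge_zero.
exact/ord_geZ/(ord_geW le)/ord_geX.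
Qed.

Lemma ord_ge_hornerB N f g (p : {poly rat}) : ord_ge 1 f -> ord_ge 1 g ->
  ord_ge N (f - g) -> ord_ge N (horner_alg f p - horner_alg g p).
Proof.
move=> hf hg h; rewrite !horner_alg_coef -sumrB; apply: ord_ge_sum => -[[|i] hi] _ /=; clear hi.
  by rewrite !expr0 subrr; apply: ord_ge_zero.
rewrite -scalerBr; apply: ord_geZ; apply: ord_geW (ord_geXB _ _ h) => //.
exact: leq_addl.
Qed.

Lemma summable_log v : ord_ge 1 v ->
  summable (fun n => ((-1) ^+ n / n.+1%:R) *: v ^+ n.+1).
Proof. by move=> hv n; apply: ord_geW (leqnSn n) _; apply/ord_geZ/ord_geX. Qed.

(** Up to any given length, both series are evaluations of truncations at
    u - 1, where [coef_exp_log] applies. *)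
Lemma sexp_slog u : u [::] = 1 -> sexp (slog u) = u.
Proof.
move=> u1; pose v := u - 1; have hv : ord_ge 1 v.
  by apply: ord_ge1; rewrite /v !seriesE u1 soneE subrr.
have sl := summable_log hv.
have hz : ord_ge 1 (slog u).
  by apply: ord_ge_ssum => k; apply/ord_geZ/(ord_geW _ (ord_geX (n := k.+1) hv)).
apply/eqP; rewrite -subr_eq0; apply/eqP/ord_ge_eq0 => N.
pose l := horner_alg v (log_poly N).
have hzl : ord_ge N (slog u - l).
  suff -> : l = \sum_(n < N) ((-1) ^+ n / n.+1%:R) *: v ^+ n.+1 by apply: ssum_tail.
  rewrite /l linear_sum; apply: eq_bigr => i _.
  exact: horner_algZXn.
have hl : ord_ge 1 l.
  apply: ord_ge_horner => // -[|//] _.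
  by rewrite coef_sum big1 // => i _; rewrite coefZ coefXn mulr0.
have -> : sexp (slog u) - u =
  (sexp (slog u) - horner_alg (slog u) (exp_poly N))
  + (horner_alg (slog u) (exp_poly N) - horner_alg l (exp_poly N))
  + horner_alg v (exp_poly N \Po log_poly N - (1 + 'X)).
  rewrite rmorphB /= horner_alg_comp -/l !addrA !subrK.
  by rewrite rmorphD rmorph1 /= horner_algX /v addrCA subrr addr0.
apply: ord_geD; first apply: ord_geD.
- apply: ord_geW (leqnSn N) _.
  suff -> : horner_alg (slog u) (exp_poly N) =
    \sum_(n < N.+1) (n`!%:R)^-1 *: slog u ^+ n by apply/ssum_tail/summable_exp.
  rewrite /exp_poly poly_def linear_sum; apply: eq_bigr => i _.
  exact: horner_algZXn.
- exact: ord_ge_hornerB.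
- apply: ord_ge_horner => // i lt.
  by rewrite coefB coef_exp_log ?subrr // ltnW.
Qed.

End ExpLog.

(** * Lie monomials and gradings by weight *)

Section Homogeneous.
Variable V : gradedSet.
Implicit Types (f g h z : series V).

Lemma shomogD k f g : shomog k f -> shomog k g -> shomog k (f + g).
Proof. by move=> hf hg; rewrite -[f]scale1r; apply: shomogP. Qed.

Lemma shomogZ k (c : rat) f : shomog k f -> shomog k (c *: f).
Proof. by move=> hf; rewrite -[_ *: _]addr0; apply/shomogP/shomog0. Qed.

Lemma shomogN k f : shomog k f -> shomog k (- f).
Proof. by rewrite -scaleN1r; apply: shomogZ. Qed.

Lemma shomogB k f g : shomog k f -> shomog k g -> shomog k (f - g).
Proof. by move=> hf hg; apply/shomogD/shomogN. Qed.

Lemma shomog1 : shomog 0 (1 : series V).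
Proof.
move=> w; rewrite soneE; case: (w =P [::]) => [-> _|_]; last by rewrite eqxx.
by rewrite /wdeg big_nil.
Qed.

Lemma shomogM i j f g : shomog i f -> shomog j g -> shomog (i + j) (f * g).
Proof.
move=> hf hg w nz; apply: contrapT => ne; move/negP: nz; apply; apply/eqP.
rewrite smulE big1 // => n _.
have [->|/hf e1] := eqVneq (f (take n w)) 0; first by rewrite mul0r.
have [->|/hg e2] := eqVneq (g (drop n w)) 0; first by rewrite mulr0.
by case: ne; rewrite (wdeg_take_drop n) e1 e2.
Qed.

Lemma shomogX n f : shomog 0 f -> shomog 0 (f ^+ n).
Proof.
move=> hf; elim: n => [|n IH]; first exact: shomog1.
by rewrite exprS -[X in shomog X]addr0; apply: shomogM.
Qed.

Lemma shomog_ssum k (F : nat -> series V) :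
  (forall n, shomog k (F n)) -> shomog k (ssum F).
Proof.
move=> hF w nz; apply: contrapT => ne; move/negP: nz; apply; apply/eqP.
rewrite /ssum big1 // => n _; apply: contrapT => /eqP /hF; exact: ne.
Qed.

Lemma shomog_sexp f : shomog 0 f -> shomog 0 (sexp f).
Proof. by move=> hf; apply: shomog_ssum => n; apply/shomogZ/shomogX. Qed.

Lemma shomog_bch f g : shomog 0 f -> shomog 0 g -> shomog 0 (bch f g).
Proof.
move=> hf hg; apply: shomog_ssum => n; apply/shomogZ/shomogX/shomogB/shomog1.
by rewrite -[X in shomog X]addr0; apply: shomogM; apply: shomog_sexp.
Qed.

Lemma sbracket_ad z f : shomog 0 z -> sbracket z f = ad z f.
Proof.
move=> hz; apply/funext => w.
rewrite /ad !seriesE !smulE -sumrB; apply: eq_bigr => n _.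
congr (_ - _); rewrite [in RHS]mulrC.
have [->|/hz ->] := eqVneq (z (drop n w)) 0; first by rewrite !mul0r mulr0.
by rewrite /ksign mulr0 expr0z mul1r.
Qed.

Lemma iter_sbracket_ad z f n : shomog 0 z ->
  iter n (sbracket z) f = iter n (ad z) f.
Proof. by move=> hz; elim: n => //= n ->; rewrite sbracket_ad. Qed.

Lemma shomog_ad k z f : shomog 0 z -> shomog k f -> shomog k (ad z f).
Proof.
by move=> hz hf; rewrite -sbracket_ad // -[k]add0r; apply: shomog_bracket.
Qed.

Lemma shomog_adser k z (a : nat -> rat) f :
  shomog 0 z -> shomog k f -> shomog k (adser z a f).
Proof.
move=> hz hf; apply: shomog_ssum => n; apply: shomogZ.
by elim: n => //= n IH; apply: shomog_ad.
Qed.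

Lemma ord_ge_bch f g : ord_ge 1 (bch f g).
Proof.
apply: ord_ge_ssum => n; apply/ord_geZ/(ord_geW _ (ord_geX (n := n.+1) _)) => //.
apply: ord_ge1; rewrite !seriesE soneE.
have -> : (sexp f * sexp g) [::] = 1 by rewrite [LHS]smul_nil !sexp_nil mulr1.
exact: subrr.
Qed.

Lemma sexp_bch f g : sexp (bch f g) = sexp f * sexp g.
Proof. by apply: sexp_slog; rewrite [LHS]smul_nil !sexp_nil mulr1. Qed.

Lemma bchA f g h : bch (bch f g) h = bch f (bch g h).
Proof.
have E (u v : series V) : bch u v = slog (sexp u * sexp v) by [].
by rewrite E sexp_bch [RHS]E sexp_bch mulrA.
Qed.

End Homogeneous.

Section LieMonomials.
Variable V : gradedSet.
Implicit Types (f g h m z : series V).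

(** Bracketings of letters. They span [free_lie], and they are homogeneous for
    the degree and for every weight, which makes it possible to use the Leibniz
    and Jacobi identities with signs on each of them. *)
Inductive lie_mono : int -> series V -> Prop :=
| lie_mono_letter x : lie_mono (gdeg x) (letter x)
| lie_mono_bracket i j f g :
    lie_mono i f -> lie_mono j g -> lie_mono (i + j) (sbracket f g).

Inductive lie_comb : series V -> Prop :=
| lie_comb0 : lie_comb 0
| lie_combS (c : rat) k m f :
    lie_mono k m -> lie_comb f -> lie_comb (c *: m + f).

Lemma lie_combP (c : rat) f g : lie_comb f -> lie_comb g -> lie_comb (c *: f + g).
Proof.
move=> + hg; elim=> [|b k m {}f hm _ IH]; first by rewrite scaler0 add0r.
by rewrite scalerDr scalerA -addrA; apply: lie_combS hm IH.
Qed.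

Lemma lie_comb_mono k m : lie_mono k m -> lie_comb m.
Proof.
by move=> hm; rewrite -[m]scale1r -[_ *: _]addr0; apply: lie_combS hm lie_comb0.
Qed.

Lemma lie_comb_bracket f g : lie_comb f -> lie_comb g -> lie_comb (sbracket f g).
Proof.
move=> + hg; elim=> [|b k m {}f hm _ IH].
  by rewrite sbracket0l; apply: lie_comb0.
rewrite sbracketPl; apply: lie_combP IH.
elim: hg => [|a j n {}g hn _ IH]; first by rewrite sbracketr0; apply: lie_comb0.
rewrite sbracketPr; apply: lie_combP IH.
exact: lie_comb_mono (lie_mono_bracket hm hn).
Qed.

Lemma free_lie_mono_ind (P : series V -> Prop) :
  P 0 -> (forall (c : rat) f g, P f -> P g -> P (c *: f + g)) ->
  (forall k m, lie_mono k m -> P m) -> forall f, free_lie f -> P f.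
Proof.
move=> P0 PL PM f hf; have: lie_comb f.
  elim: hf => [x||c {}f g _ IHf _ IHg|{}f g _ IHf _ IHg].
  - exact: lie_comb_mono (lie_mono_letter x).
  - exact: lie_comb0.
  - exact: lie_combP.
  - exact: lie_comb_bracket.
elim=> [//|c k m g hm _ IH]; apply: PL IH; exact: PM hm.
Qed.

Lemma lie_mono_homog k m : lie_mono k m -> shomog k m.
Proof.
elim=> [x|i j f g _ IHf _ IHg]; first exact: letter_homog.
exact: shomog_bracket.
Qed.

Lemma lie_mono_free k m : lie_mono k m -> free_lie m.
Proof.
elim=> [x|i j f g _ IHf _ IHg]; first exact: free_lie_gen.
exact: free_lie_bracket.
Qed.

Lemma free_lieZ (c : rat) f : free_lie f -> free_lie (c *: f).
Proof.
by move=> hf; rewrite -[_ *: _]addr0; apply/free_lie_lin/free_lie_zero.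
Qed.

Lemma free_lieD f g : free_lie f -> free_lie g -> free_lie (f + g).
Proof. by move=> hf hg; rewrite -[f]scale1r; apply: free_lie_lin. Qed.

Lemma free_lie_sum I (r : seq I) (P : pred I) (F : I -> series V) :
  (forall i, P i -> free_lie (F i)) -> free_lie (\sum_(i <- r | P i) F i).
Proof.
by move=> hF; elim/big_ind: _ => //; [apply: free_lie_zero|apply: free_lieD].
Qed.

Lemma free_lie_ord f : free_lie f -> ord_ge 1 f.
Proof.
elim=> [x||c {}f g _ IHf _ IHg|{}f g _ IHf _ IHg].
- exact: ord_ge_letter.
- exact: ord_ge_zero.
- by apply: ord_geD IHg; apply: ord_geZ.
- by apply: ord_ge1; rewrite /sbracket big_ord1 /= IHf // mul0r mulr0 subrr.
Qed.

Lemma in_hatL_ord f : in_hatL f -> ord_ge 1 f.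
Proof.
by move=> [_ /(_ 1%N)[p hp e]] w lt; rewrite e ?(free_lie_ord hp) // ltnW.
Qed.

Lemma in_hatL_approx f n : in_hatL f -> exists2 p, free_lie p & ord_ge n (f - p).
Proof.
move=> [_ /(_ n)[p hp e]]; exists p => // w lt.
by rewrite !seriesE e ?subrr // ltnW.
Qed.

Lemma in_hatL_homogI k f : shomog k f ->
  (forall n, exists2 p, free_lie p & ord_ge n (f - p)) -> in_hatL f.
Proof.
move=> hf ha; split; first by exists `|k|%N => w /hf ->; lia.
move=> n; have [p hp o] := ha n.+1; exists p => // w le.
by apply/eqP; rewrite -subr_eq0; apply/eqP/(o w).
Qed.

Lemma in_hatL_mono k m : lie_mono k m -> in_hatL m.
Proof.
move=> hm; apply: (in_hatL_homogI (lie_mono_homog hm)) => n; exists m.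
  exact: lie_mono_free hm.
by rewrite subrr; apply: ord_ge_zero.
Qed.

Lemma in_hatLZ (c : rat) f : in_hatL f -> in_hatL (c *: f).
Proof. by move=> hf; rewrite -[_ *: _]addr0; apply/in_hatLP/in_hatL0. Qed.

Lemma in_hatLD f g : in_hatL f -> in_hatL g -> in_hatL (f + g).
Proof. by move=> hf hg; rewrite -[f]scale1r; apply: in_hatLP. Qed.

Lemma in_hatLN f : in_hatL f -> in_hatL (- f).
Proof. by rewrite -scaleN1r; apply: in_hatLZ. Qed.

Lemma in_hatLB f g : in_hatL f -> in_hatL g -> in_hatL (f - g).
Proof. by move=> hf hg; apply/in_hatLD/in_hatLN. Qed.

Lemma in_hatL_sum I (r : seq I) (P : pred I) (F : I -> series V) :
  (forall i, P i -> in_hatL (F i)) -> in_hatL (\sum_(i <- r | P i) F i).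
Proof.
by move=> hF; elim/big_ind: _ => //; [apply: in_hatL0|apply: in_hatLD].
Qed.

Lemma in_hatL_ssum k (F : nat -> series V) : summable F ->
  (forall n, shomog k (F n)) -> (forall n, in_hatL (F n)) -> in_hatL (ssum F).
Proof.
move=> sF hF lF; apply: (@in_hatL_homogI k); first exact: shomog_ssum.
move=> n.
have : in_hatL (\sum_(i < n) F i) by apply: in_hatL_sum.
move=> /(in_hatL_approx n)[p hp o]; exists p => //.
by rewrite -[ssum F](subrK (\sum_(i < n) F i)) -addrA; apply: ord_geD (ssum_tail sF) o.
Qed.

Lemma in_hatL_adser k z (a : nat -> rat) f : in_hatL z -> shomog 0 z ->
  in_hatL f -> shomog k f -> in_hatL (adser z a f).
Proof.
move=> lz hz lf hf; apply: (@in_hatL_ssum k).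
- exact/summable_adser/in_hatL_ord.
- move=> n; apply: shomogZ; elim: n => //= n IH; exact: shomog_ad.
- move=> n; apply: in_hatLZ; elim: n => //= n IH.
  by rewrite -sbracket_ad //; apply: in_hatL_bracket.
Qed.

End LieMonomials.

Section Weight.
Variables (V : gradedSet) (c : V -> nat).
Implicit Types (f g h m z : series V).

(** The constant weight 1 gives the length of words, the indicator function of a
    letter counts its occurrences. *)
Definition weight (w : seq V) : nat := \sum_(x <- w) c x.

Lemma weight_cat u v : weight (u ++ v) = (weight u + weight v)%N.
Proof. by rewrite /weight big_cat. Qed.

Definition weight_proj k f : series V := fun w => if weight w == k then f w else 0.

(** The Euler derivation of the grading. *)
Definition weight_der f : series V := fun w => (weight w)%:R * f w.

Lemma ord_linear_weight_proj k : ord_linear (weight_proj k).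
Proof.
split=> [a f g|n f hf w lt]; last by rewrite /weight_proj hf ?if_same.
apply/funext => w; rewrite !seriesE /weight_proj; case: ifP => // _.
by rewrite mulr0 addr0.
Qed.

Lemma ord_linear_weight_der : ord_linear weight_der.
Proof.
split=> [a f g|n f hf w lt]; last by rewrite /weight_der hf ?mulr0.
by apply/funext => w; rewrite !seriesE /weight_der !seriesE mulrDr mulrCA.
Qed.

Lemma weight_der1 : weight_der 1 = 0.
Proof.
apply/funext => w; rewrite /weight_der soneE; case: (w =P [::]) => [->|_].
  by rewrite /weight big_nil mul0r.
by rewrite mulr0.
Qed.

Lemma weight_derM f g : weight_der (f * g) = weight_der f * g + f * weight_der g.
Proof.
apply/funext => w; rewrite /weight_der !seriesE !smulE mulr_sumr -big_split /=.
apply: eq_bigr => i _; rewrite -{1}(cat_take_drop i w) weight_cat natrD.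
by ring.
Qed.

(** Weights are nonnegative, so killing the words of positive weight is an
    algebra morphism. *)
Lemma weight_proj0M f g : weight_proj 0 (f * g) = weight_proj 0 f * weight_proj 0 g.
Proof.
apply/funext => w; rewrite /weight_proj !smulE.
case: ifP => [/eqP w0|/negbT w0].
  apply: eq_bigr => i _; move: w0; rewrite -{1}(cat_take_drop i w) weight_cat.
  by move/eqP; rewrite addn_eq0 => /andP[-> ->].
rewrite big1 // => i _; move: w0; rewrite -{1}(cat_take_drop i w) weight_cat.
by rewrite addn_eq0 negb_and => /orP[/negbTE ->|/negbTE ->]; rewrite ?mul0r ?mulr0.
Qed.

Lemma weight_proj01 : weight_proj 0 1 = 1.
Proof.
apply/funext => w; rewrite /weight_proj soneE; case: (w =P [::]) => [->|_]; last exact: if_same.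
by rewrite /weight big_nil.
Qed.

Lemma weight_proj0_sexp f : ord_ge 1 f -> weight_proj 0 (sexp f) = sexp (weight_proj 0 f).
Proof.
move=> hf; rewrite (ord_lin_ssum (ord_linear_weight_proj 0)); last exact: summable_exp.
apply: eq_ssum => n; rewrite (ord_linZ (ord_linear_weight_proj 0)); congr (_ *: _).
elim: n => [|n IH]; first exact: weight_proj01.
by rewrite !exprS weight_proj0M IH.
Qed.

Lemma lie_mono_weight k m : lie_mono k m ->
  exists n, forall w, m w != 0 -> weight w = n.
Proof.
elim=> [x|i j f g _ [n1 h1] _ [n2 h2]].
  exists (c x) => w; rewrite /letter; case: (w =P [:: x]) => [->|_]; last by rewrite eqxx.
  by rewrite /weight big_seq1.
exists (n1 + n2)%N => w /sbracket_supp[[u v] /= <-]; rewrite weight_cat.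
by case/orP=> /andP[/h1 -> /h2 ->] //; rewrite addnC.
Qed.

Lemma free_lie_weight_proj k f : free_lie f -> free_lie (weight_proj k f).
Proof.
have hl := ord_linear_weight_proj k.
move: f; apply: free_lie_mono_ind => [|b f g hf hg|i m hm].
- by rewrite (ord_lin0 hl); apply: free_lie_zero.
- by rewrite (ord_linP hl); apply: free_lie_lin.
- have [n hn] := lie_mono_weight hm.
  have [e|ne] := eqVneq n k.
    suff -> : weight_proj k m = m by apply: lie_mono_free hm.
    apply/funext => w; rewrite /weight_proj; case: ifP => // /negbT.
    by have [//|/hn ->] := eqVneq (m w) 0; rewrite e eqxx.
  suff -> : weight_proj k m = 0 by apply: free_lie_zero.
  apply/funext => w; rewrite /weight_proj; case: ifP => // /eqP.
  by have [//|/hn -> e] := eqVneq (m w) 0; rewrite e eqxx in ne.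
Qed.

End Weight.

(** * The Baker-Campbell-Hausdorff product is a Lie series *)

Section BchLie.
Variable V : gradedSet.
Implicit Types (f g z p q : series V) (y : V).

Lemma adser_self z (a : nat -> rat) : adser z a z = a 0%N *: z.
Proof.
rewrite /adser ssum_head // => n.
rewrite iterSr /ad subrr (ord_lin0 (ord_linear_iter_ad z n)).
exact: scaler0.
Qed.

Lemma ord_ge_iter_adB n m z p c : ord_ge 1 z -> ord_ge 1 p -> ord_ge 1 c ->
  ord_ge n (z - p) -> ord_ge n.+1 (iter m (ad z) c - iter m (ad p) c).
Proof.
move=> hz hp hc h; elim: m => [|m IH]; first by rewrite subrr; apply: ord_ge_zero.
rewrite !iterS; set A := iter m (ad z) c; set B := iter m (ad p) c.
have -> : ad z A - ad p B = ad (z - p) A + ad p (A - B).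
  rewrite /ad !(mulrBl, mulrBr) !opprB !addrA.
  apply/funext => w; rewrite !seriesE; ring.
apply: ord_geD; last by apply: (ord_lin_ge (ord_linear_ad p)).
rewrite -addn1; apply: ord_ge_ad h _.
by apply: ord_geW (ord_ge_iter_ad (n := m) hz hc); rewrite addn1.
Qed.

Definition avoids y f := forall w, y \in w -> f w = 0.

Definition occ y (x : V) : nat := x == y.

Lemma weight_occ y w : (weight (occ y) w == 0%N) = (y \notin w).
Proof.
rewrite /weight sum_nat_seq_eq0; apply/allP/idP => [h|yw x xw].
  by apply/negP => /h; rewrite /= /occ eqxx.
by rewrite /= /occ eqb0; apply: contraNneq yw => <-.
Qed.

Lemma avoidsP y f : avoids y f <-> weight_proj (occ y) 0 f = f.
Proof.
split=> [h|<- w yw]; last by rewrite /weight_proj weight_occ yw.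
by apply/funext => w; rewrite /weight_proj weight_occ; case: ifP => // /negbFE /h ->.
Qed.

Lemma avoids_letter x y : x != y -> avoids y (letter x).
Proof.
move=> ne w; rewrite /letter; case: (w =P [:: x]) => // ->.
by rewrite inE eq_sym (negbTE ne).
Qed.

Lemma weight_proj0_bch (c : V -> nat) f g : ord_ge 1 f -> ord_ge 1 g ->
  weight_proj c 0 (bch f g) = bch (weight_proj c 0 f) (weight_proj c 0 g).
Proof.
move=> hf hg; apply: sexp_inj; last 1 first.
- rewrite -weight_proj0_sexp; last exact: ord_ge_bch.
  by rewrite !sexp_bch weight_proj0M (weight_proj0_sexp c hf) (weight_proj0_sexp c hg).
- exact/(ord_lin_ge (ord_linear_weight_proj c 0))/ord_ge_bch.
- exact: ord_ge_bch.
Qed.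

Lemma avoids_bch y f g : ord_ge 1 f -> ord_ge 1 g ->
  avoids y f -> avoids y g -> avoids y (bch f g).
Proof.
by move=> hf hg /avoidsP ef /avoidsP eg; apply/avoidsP; rewrite weight_proj0_bch ?ef ?eg.
Qed.

(** The derivation counting y kills e^g and multiplies e^y by y on the left,
    hence also e^y e^g. *)
Lemma weight_der_bch y g : avoids y g -> ord_ge 1 g ->
  weight_der (occ y) (bch (letter y) g) = adser (bch (letter y) g) todd (letter y).
Proof.
set c := occ y; move=> gy og; have hE := ord_linear_weight_der c.
have EX z n : weight_der c (z ^+ n * z) = weight_der c (z ^+ n) * z + z ^+ n * weight_der c z.
  exact: weight_derM.
have Eg : weight_der c g = 0.
  apply/funext => w; rewrite /weight_der; have [/gy ->|yw] := boolP (y \in w).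
    exact: mulr0.
  by move: yw; rewrite -weight_occ => /eqP ->; rewrite mul0r.
have Ey : weight_der c (letter y) = letter y.
  apply/funext => w; rewrite /weight_der /letter; case: (w =P [:: y]) => [->|_].
    by rewrite /weight big_seq1 /c /occ eqxx mul1r.
  exact: mulr0.
apply: (derivation_log hE (weight_der1 c) (EX _)); first exact: ord_ge_bch.
rewrite !sexp_bch weight_derM.
rewrite (derivation_exp hE (weight_der1 c) (EX _) (ord_ge_letter y)) Ey adser_self.
rewrite (derivation_exp hE (weight_der1 c) (EX _) og) Eg (ord_lin0 (ord_linear_adser _ _)).
by rewrite mul0r mulr0 addr0 /expc invr1 scale1r mulrA.
Qed.

(** Let z = bch y g. The words of z without y form g. On a word with k > 0
    occurrences of y, z is 1/k times the Bernoulli series of ad_z applied to y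
    [weight_der_bch]; as y has length 1, this series involves z in smaller lengths
    only, where it can be replaced by a Lie polynomial p. *)
Lemma in_hatL_bch_letter y g : gdeg y = 0 -> shomog 0 g -> in_hatL g ->
  avoids y g -> in_hatL (bch (letter y) g).
Proof.
move=> y0 hg lg gy; have og := in_hatL_ord lg.
have hy : shomog 0 (letter y) by rewrite -y0; apply: letter_homog.
pose c := occ y; set z := bch _ g.
have hz : shomog 0 z by apply: shomog_bch.
have oz : ord_ge 1 z := ord_ge_bch _ _.
have Ez : weight_der c z = adser z todd (letter y) := weight_der_bch gy og.
have z0 : weight_proj c 0 z = g.
  rewrite weight_proj0_bch ?(avoidsP y g).1 //; last exact: ord_ge_letter.
  have -> : weight_proj c 0 (letter y) = 0.
    apply/funext => w; rewrite /weight_proj weight_occ /letter szeroE.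
    by case: ifP => //; case: (w =P [:: y]) => // ->; rewrite mem_head.
  apply: sexp_inj; [exact: ord_ge_bch|exact: og|].
  by rewrite sexp_bch sexp0 mul1r.
apply: (in_hatL_homogI hz) => n.
(* The approximation is kept of degree 0, so that its commutators are graded
   brackets. *)
suff [p [hp lp op]] : exists p, [/\ shomog 0 p, free_lie p & ord_ge n (z - p)].
  by exists p.
elim: n => [|n [p [hp lp op]]].
  by exists 0; split; [apply: shomog0|apply: free_lie_zero|].
have opp := free_lie_ord lp.
pose q := \sum_(m < n.+1) todd m *: iter m (ad p) (letter y).
have lq : free_lie q.
  apply: free_lie_sum => m _; apply: free_lieZ; rewrite -iter_sbracket_ad //.
  elim: (m : nat) => [|k IH]; first exact: free_lie_gen.
  exact: free_lie_bracket.
have oq : ord_ge n.+1 (weight_der c z - q).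
  rewrite Ez -[adser _ _ _](subrK
    (\sum_(m < n.+1) todd m *: iter m (ad z) (letter y))) -addrA.
  apply: ord_geD; first exact/ssum_tail/summable_adser.
  rewrite /q -sumrB; apply: ord_ge_sum => m _; rewrite -scalerBr.
  by apply/ord_geZ/ord_ge_iter_adB => //; apply: ord_ge_letter.
(* A word of length at most n contains y at most n times, so dividing by the
   number of occurrences inverts weight_der up to length n. *)
have [r lr or] := in_hatL_approx n.+1 lg.
pose p' := r + \sum_(1 <= k < n.+1) k%:R^-1 *: weight_proj c k q.
have lp' : free_lie p'.
  apply: free_lieD => //; apply: free_lie_sum => k _.
  exact/free_lieZ/free_lie_weight_proj.
exists (sproj 0 p'); split; [exact: sproj_homog|exact: free_lie_proj|].
suff op' : ord_ge n.+1 (z - p').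
  rewrite -(sproj_id hz) => w lt; have := op' w lt; rewrite !seriesE /sproj.
  by case: ifP => // _ _; rewrite subrr.
move=> w lt; have := or w lt; have := oq w lt; rewrite !seriesE /p' !seriesE.
rewrite series_sumE /weight_der => /eqP; rewrite subr_eq0 => /eqP eq.
move=> /eqP; rewrite subr_eq0 => /eqP er.
have ez : z w = g w + (if weight c w == 0%N then 0 else z w).
  by rewrite -z0 /weight_proj; case: ifP; rewrite ?addr0 ?add0r.
rewrite {}ez -er; case: ifP => [/eqP w0|/negbT w0].
  rewrite big1_seq ?subrr // => k; rewrite mem_index_iota => /andP[_ hk].
  by rewrite seriesE /weight_proj w0; case: eqP; rewrite ?mulr0 //; lia.
have le : (weight c w <= n)%N.
  apply: (@leq_trans (size w)) => //; rewrite /weight -sum1_size.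
  by apply: leq_sum => x _; apply: leq_b1.
rewrite (bigD1_seq (weight c w)) ?iota_uniq //=; last by rewrite mem_index_iota; lia.
rewrite big1.
  rewrite seriesE /weight_proj eqxx -eq. by rewrite mulKf ?pnatr_eq0 // addr0 subrr.
move=> k ne; change (k%:R^-1 * weight_proj c k q w = 0).
by rewrite /weight_proj eq_sym (negbTE ne) mulr0.
Qed.

End BchLie.

(** * Continuous derivations of the completed tensor algebra *)

Section Letters.
Variable V : gradedSet.
Implicit Types (f g : series V) (x y : V).

Definition ldiv x f : series V := fun u => f (x :: u).

Lemma ldiv_letter x y : ldiv y (letter x) = (y == x)%:R *: (1 : series V).
Proof. by apply/funext => u; rewrite /ldiv /letter eqseq_cons -mulnb natrM. Qed.

Lemma ldiv1 x : ldiv x 1 = 0.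
Proof. by []. Qed.

Lemma mulE_cons f g y w :
  (f * g) (y :: w) = f [::] * g (y :: w) + (ldiv y f * g) w.
Proof. exact: smul_cons. Qed.

Lemma ldivM x f g : ldiv x (f * g) = f [::] *: ldiv x g + ldiv x f * g.
Proof. by apply/funext => w; apply: mulE_cons. Qed.

Lemma letter_decomp f : f = f [::] *: 1 + \sum_x letter x * ldiv x f.
Proof.
apply/funext => -[|y w]; rewrite !seriesE series_sumE.
  rewrite soneE mulr1 big1 ?addr0 // => x _.
  by rewrite [LHS]smul_nil mul0r.
rewrite soneE mulr0 add0r (bigD1 y) //= big1 ?addr0 => [|x ne].
  by rewrite mulE_cons mul0r add0r ldiv_letter eqxx scale1r mul1r.
by rewrite mulE_cons mul0r add0r ldiv_letter eq_sym (negbTE ne) scale0r mul0r.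
Qed.

Lemma smul_supp f g w : (f * g) w != 0 ->
  exists2 uv, uv.1 ++ uv.2 = w & f uv.1 != 0 /\ g uv.2 != 0.
Proof.
move=> nz; apply: contrapT => H; move/negP: nz; apply; apply/eqP.
rewrite smulE big1 // => i _; apply: contrapT => /eqP nz; apply: H.
exists (take i w, drop i w); first exact: cat_take_drop.
by move: nz; rewrite mulf_eq0 negb_or => /andP.
Qed.

(** A series without constant term is a sum of letters times series, and E
    multiplies by a series of positive order when it passes a letter: iterating,
    the order of E f is unbounded. *)
Lemma letters_determine (W : gradedSet) (E : series V -> series W) :
  (forall (c : rat) f g, E (c *: f + g) = c *: E f + E g) -> E 1 = 0 ->
  (forall x g, exists2 q, ord_ge 1 q & E (letter x * g) = q * E g) ->
  forall f, E f = 0.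
Proof.
move=> EP E1 EM.
have E0 : E 0 = 0.
  by have := EP (-1) 0 0; rewrite scaler0 addr0 scaleN1r addNr.
have ED f g : E (f + g) = E f + E g by rewrite -[f]scale1r EP !scale1r.
suff H n f : ord_ge n (E f) by move=> f; apply: ord_ge_eq0.
elim: n f => [|n IH] f; first exact: ord_ge0.
rewrite [f]letter_decomp EP E1 scaler0 add0r (big_morph E ED E0).
apply: ord_ge_sum => x _; have [q oq ->] := EM x (ldiv x f).
by rewrite -add1n; apply: ord_geM.
Qed.

End Letters.

Lemma signzN (k : int) : (-1 : rat) ^ (- k) = (-1) ^ k.
Proof. by rewrite -exprz_inv invrN1. Qed.

Lemma signzK (k : int) : (-1 : rat) ^ k * (-1) ^ k = 1.
Proof. by rewrite -{1}(signzN k) -expfzDr // addNr. Qed.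

Lemma signz_pred (k : int) : (-1 : rat) ^ (k - 1) = - (-1) ^ k.
Proof. by rewrite expfzDr // mulrN1. Qed.

Section Derivation.
Variables (V : gradedSet) (d : V -> series V).
Implicit Types (f g : series V) (x y : V).

Definition dsum f : series V := \sum_x d x * ldiv x f.

(** On words, D (y u) = d(y) u + (-1)^|y| y D(u). Summing over the first letter,
    D f = sum of d(x) f_x + sum of (-1)^|y| y D(f_y), where f_x is the left
    quotient [ldiv x f]. The first sum is [dsum], and the coefficient of y u in
    the second one is that of u in D(f_y), up to sign. *)
Fixpoint sder_coef f (w : seq V) {struct w} : rat :=
  dsum f w + if w is y :: u then (-1) ^ gdeg y * sder_coef (ldiv y f) u else 0.

Definition sder f : series V := sder_coef f.

Lemma sder_cons f y u :
  sder f (y :: u) = dsum f (y :: u) + (-1) ^ gdeg y * sder (ldiv y f) u.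
Proof. by []. Qed.

Lemma sder_nil f : sder f [::] = dsum f [::].
Proof. exact: addr0. Qed.

Lemma dsumP (c : rat) f g : dsum (c *: f + g) = c *: dsum f + dsum g.
Proof.
rewrite /dsum scaler_sumr -big_split /=; apply: eq_bigr => x _.
by rewrite scalerAr -mulrDr.
Qed.

Lemma dsumM f g : dsum (f * g) = f [::] *: dsum g + dsum f * g.
Proof.
rewrite /dsum scaler_sumr mulr_suml -big_split /=; apply: eq_bigr => x _.
by rewrite ldivM mulrDr scalerAr mulrA.
Qed.

Lemma sderP (c : rat) f g : sder (c *: f + g) = c *: sder f + sder g.
Proof.
apply/funext => w; rewrite !seriesE.
elim: w f g => [|y w IH] f g; first by rewrite !sder_nil dsumP.
rewrite !sder_cons dsumP !seriesE [ldiv _ _](_ : _ = c *: ldiv y f + ldiv y g) //.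
rewrite IH; ring.
Qed.

Lemma sder0 : sder 0 = 0.
Proof.
have := sderP (-1) 0 0; rewrite scaler0 addr0 scaleN1r => ->.
exact: addNr.
Qed.

Lemma sder1 : sder 1 = 0.
Proof.
have e0 : dsum 1 = 0 by rewrite /dsum big1 // => x _; rewrite ldiv1 mulr0.
apply/funext => -[|y w]; first by rewrite sder_nil e0.
by rewrite sder_cons e0 ldiv1 sder0 mulr0 addr0.
Qed.

Lemma sder_letter x : sder (letter x) = d x.
Proof.
have e : dsum (letter x) = d x.
  rewrite /dsum (bigD1 x) //= big1 ?addr0 => [|y ne].
    by rewrite ldiv_letter eqxx scale1r mulr1.
  by rewrite ldiv_letter (negbTE ne) scale0r mulr0.
apply/funext => -[|y w]; first by rewrite sder_nil e.
rewrite sder_cons e ldiv_letter -[_ *: _]addr0 sderP sder1 sder0 scaler0 addr0.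
by rewrite szeroE mulr0 addr0.
Qed.

Lemma sderM k f g : shomog k f ->
  sder (f * g) = sder f * g + (-1) ^ k *: (f * sder g).
Proof.
move=> hf; apply/funext => w; rewrite !seriesE.
have f0 (j : int) (h : series V) : shomog j h -> (-1) ^ j * h [::] = h [::] :> rat.
  move=> hh; have [->|/hh <-] := eqVneq (h [::]) 0; first by rewrite mulr0.
  by rewrite /wdeg big_nil expr0z mul1r.
elim: w f k hf => [|y w IH] f k hf.
  rewrite sder_nil dsumM !seriesE [(sder f * g) _]smul_nil [(f * sder g) _]smul_nil.
  rewrite !sder_nil [(dsum f * g) _]smul_nil mulrA (f0 _ _ hf).
  exact: addrC.
have hy : shomog (k - gdeg y) (ldiv y f).
  by move=> u /hf <-; rewrite /wdeg big_cons addrC addKr.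
rewrite sder_cons dsumM ldivM sderP !seriesE (IH _ _ hy).
rewrite !mulE_cons !sder_cons sder_nil.
have -> : (ldiv y (sder f) * g) w =
   (ldiv y (dsum f) * g) w + (-1) ^ gdeg y * (sder (ldiv y f) * g) w.
  have -> : ldiv y (sder f) =
    (-1) ^ gdeg y *: sder (ldiv y f) + ldiv y (dsum f).
    by apply/funext => u; rewrite !seriesE addrC.
  by rewrite mulrDl -scalerAl !seriesE addrC.
have -> : (-1) ^ (k - gdeg y) = (-1) ^ k * (-1) ^ gdeg y :> rat.
  by rewrite expfzDr // signzN.
have e := f0 _ _ hf; have s := signzK (gdeg y).
set a := (-1) ^ k in e *; set b := (-1) ^ gdeg y in s *.
set A := (ldiv y f * _) w; set B := (_ * g) w; set C := (_ * g) w.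
rewrite -[f [::] in LHS]e {e}.
set S := sder _ w; set x := f [::].
have -> : b * (a * x * S + (C + a * b * A)) = b * (a * x * S) + b * C + a * A * (b * b).
  by ring.
by rewrite s; ring.
Qed.

Lemma sderZ (c : rat) f : sder (c *: f) = c *: sder f.
Proof. by rewrite -[c *: f]addr0 sderP sder0 addr0. Qed.

Lemma sderD f g : sder (f + g) = sder f + sder g.
Proof. by rewrite -[f]scale1r sderP !scale1r. Qed.

Lemma sderN f : sder (- f) = - sder f.
Proof. by rewrite -scaleN1r sderZ scaleN1r. Qed.

Lemma sderB f g : sder (f - g) = sder f - sder g.
Proof. by rewrite sderD sderN. Qed.

Lemma sder_mull f g : shomog 0 f -> sder (f * g) = sder f * g + f * sder g.
Proof. by move=> /sderM ->; rewrite expr0z scale1r. Qed.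

Lemma sder_bracket i j f g : shomog i f -> shomog j g ->
  (forall k h, shomog k h -> shomog (k - 1) (sder h)) ->
  sder (sbracket f g) = sbracket (sder f) g + (-1) ^ i *: sbracket f (sder g).
Proof.
move=> hf hg hD.
rewrite (sbracketE hf hg) (sbracketE (hD _ _ hf) hg) (sbracketE hf (hD _ _ hg)).
rewrite sderB sderZ (sderM _ hf) (sderM _ hg) /ksign.
have -> : (i - 1) * j = i * j - j by ring.
have -> : i * (j - 1) = i * j - i by ring.
have E m : (-1 : rat) ^ (i * j - m) = (-1) ^ (i * j) * (-1) ^ m.
  by rewrite expfzDr // signzN.
rewrite !E {E}.
have s := signzK i.
apply/funext => w; rewrite !seriesE.
set a := (-1) ^ i in s *; set b := (-1) ^ j; set e := (-1) ^ (i * j).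
have -> : forall x y : rat, a * (x - e * a * y) = a * x - e * y * (a * a).
  by move=> x y; ring.
by rewrite s; ring.
Qed.

Section Degree.
Hypothesis hd : forall x, shomog (gdeg x - 1) (d x).

Lemma sder_supp f w : sder f w != 0 -> exists2 u, f u != 0 & wdeg w = wdeg u - 1.
Proof.
have dsum_supp h v : dsum h v != 0 -> exists2 u, h u != 0 & wdeg v = wdeg u - 1.
  move=> nz; apply: contrapT => H; move/negP: nz; apply; apply/eqP.
  rewrite /dsum series_sumE big1 // => x _; apply: contrapT => /eqP.
  move=> /smul_supp[[p q] /= e [/hd dp hq]]; apply: H; exists (x :: q) => //.
  by rewrite -e wdeg_cat dp /wdeg big_cons addrAC.
elim: w f => [|y w IH] f; first by rewrite sder_nil; apply: dsum_supp.
rewrite sder_cons; have [->|/dsum_supp //] := eqVneq (dsum f (y :: w)) 0.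
rewrite add0r mulf_eq0 negb_or => /andP[_ /IH[u fu e]].
by exists (y :: u) => //; rewrite /wdeg !big_cons -!/(wdeg _) e addrA.
Qed.

Lemma sder_homog k f : shomog k f -> shomog (k - 1) (sder f).
Proof. by move=> hf w /sder_supp[u /hf <-]. Qed.

(** The square of an odd derivation is an even derivation. *)
Lemma sder_sq0 : (forall x, sder (d x) = 0) -> forall f, sder (sder f) = 0.
Proof.
move=> dd; apply: letters_determine => [c f g||x g]; first by rewrite !sderP.
  by rewrite sder1 sder0.
exists (letter x); first exact: ord_ge_letter.
rewrite (sderM _ (letter_homog (x := x))) sder_letter sderD sderZ.
rewrite (sderM _ (@hd x)) (sderM _ (letter_homog (x := x))) sder_letter dd mul0r add0r.
rewrite signz_pred scalerDr scalerA signzK scale1r addrA.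
by rewrite scaleNr addNr add0r.
Qed.

Hypothesis od : forall x, ord_ge 1 (d x).

Lemma ord_linear_sder : ord_linear sder.
Proof.
split=> [|n f hf w]; first exact: sderP.
elim: w n f hf => [|y w IH] [//|n] f hf lt.
  rewrite sder_nil /dsum series_sumE big1 // => x _.
  by rewrite [LHS]smul_nil od // mul0r.
have hy x : ord_ge n (ldiv x f) by move=> u lu; apply: hf.
rewrite sder_cons (IH n) // mulr0 addr0 /dsum series_sumE big1 // => x _.
by have := ord_geM (od x) (hy x); apply.
Qed.

Hypothesis ld : forall x, in_hatL (d x).

(** Lie polynomials are treated on bracket monomials with the Leibniz rule, and
    Lie series follow because D does not decrease the length of words. *)
Lemma in_hatL_sder f : in_hatL f -> in_hatL (sder f).
Proof.
move=> lf; split.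
  have [[N hN] _] := lf; exists N.+1 => w /sder_supp[u /hN]; lia.
move=> n; have [p lp op] := in_hatL_approx n.+1 lf.
have lsp : in_hatL (sder p).
  move: p lp {op}; apply: free_lie_mono_ind.
  - by rewrite sder0; apply: in_hatL0.
  - by move=> c g h; rewrite sderP; apply: in_hatLP.
  move=> k m; elim=> [x|i j g h mg IHg mh IHh]; first by rewrite sder_letter.
  rewrite (sder_bracket (lie_mono_homog mg) (lie_mono_homog mh)) //; last exact: sder_homog.
  by apply: in_hatLD; [|apply: in_hatLZ]; apply: in_hatL_bracket => //;
    apply: in_hatL_mono; eassumption.
have [_ /(_ n)[q lq eq]] := lsp; exists q => // w le; rewrite -eq //.
have := ord_lin_ge ord_linear_sder op (w := w); rewrite sderB !seriesE => /(_ le).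
by move/eqP; rewrite subr_eq0 => /eqP.
Qed.

End Degree.
End Derivation.

Lemma ord_linear_push (V W : gradedSet) (h : V -> W) : ord_linear (push h).
Proof.
split=> [|n f hf w lt]; first exact: pushP.
by rewrite /push big1 // => u _; apply: hf; rewrite size_tuple.
Qed.

Lemma push_sder (V W : gradedSet) (h : V -> W) (d : V -> series V) (d' : W -> series W) :
  (forall v, gdeg (h v) = gdeg v) ->
  (forall v, push h (d v) = d' (h v)) ->
  forall f, push h (sder d f) = sder d' (push h f).
Proof.
move=> deg_h hd f; apply/eqP; rewrite -subr_eq0; apply/eqP; move: f.
apply: letters_determine => [c f g||v g].
- by rewrite !(sderP, pushP) scalerBr opprD addrACA.
- by rewrite sder1 push0 push1 sder1 subrr.
exists ((-1) ^ gdeg v *: letter (h v)); first exact/ord_geZ/ord_ge_letter.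
rewrite pushM push_letter (sderM _ _ (letter_homog (x := v))).
rewrite (sderM _ _ (letter_homog (x := h v))) !sder_letter.
rewrite pushD pushZ !pushM push_letter hd deg_h opprD addrACA subrr add0r.
by rewrite -scalerBr -mulrBr scalerAl.
Qed.

Section HatDerivation.
Variables (V : gradedSet) (d : V -> series V).
Hypothesis hd : forall x, shomog (gdeg x - 1) (d x).
Hypothesis ld : forall x, in_hatL (d x).

Let od x : ord_ge 1 (d x) := in_hatL_ord (ld x).

Definition hatL_der (f : hatL V) : hatL V :=
  mk_hatL (in_hatL_sder hd od ld (hatL_in f)).

End HatDerivation.

Lemma graded_lie_homog_ext (L : gradedLie) (M : lmodType rat) (F : L -> M) :
  (forall (c : rat) x y, F (c *: x + y) = c *: F x + F y) ->
  (forall k x, homog k x -> F x = 0) -> forall x, F x = 0.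
Proof.
move=> FP F0 x; have [s _ [y hy ->]] := homog_span x.
have FD u v : F (u + v) = F u + F v by rewrite -[u]scale1r FP !scale1r.
rewrite (big_morph F FD (F0 0 0 (@homog0 L 0))) big1 // => k _.
exact: F0 (hy k).
Qed.

Lemma hatL_der_derivation (V : gradedSet) (d : V -> series V) hd ld :
  is_derivation (@hatL_der V d hd ld).
Proof.
split=> [c x y|k x hx|k x y hx]; first by apply: hatL_inj; apply: sderP.
  exact: sder_homog.
move: y; pose D := hatL_der hd ld.
pose F y : hatL V := D (bracket x y) - (bracket (D x) y + (-1) ^ k *: bracket x (D y)).
suff F0 y : F y = 0 by move=> y; apply/eqP; rewrite -subr_eq0; apply/eqP/F0.
have DP c u v : D (c *: u + v) = c *: D u + D v by apply: hatL_inj; apply: sderP.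
apply: graded_lie_homog_ext y => [c u v|j u hu].
  rewrite /F !(bracketPr, DP) [(-1) ^ k *: _]scalerDr scalerA mulrC -scalerA.
  by rewrite [X in _ - X]addrACA -scalerDr opprD addrACA -scalerBr.
apply/eqP; rewrite subr_eq0; apply/eqP/hatL_inj.
apply: (sder_bracket (i := k) (j := j)) => //; exact: sder_homog.
Qed.

(** * Intervals and triangles *)

Section Interval.
Variables (V : gradedSet) (d : V -> series V).
Hypothesis hd : forall x, shomog (gdeg x - 1) (d x).
Hypothesis od : forall x, ord_ge 1 (d x).
Implicit Types (a b c f x y z t : series V).

Let D := sder d.
Let hD k f : shomog k f -> shomog (k - 1) (D f).
Proof. exact: sder_homog. Qed.
Let lD : ord_linear D.
Proof. exact: ord_linear_sder. Qed.

Let DX x n : shomog 0 x -> D (x ^+ n * x) = D (x ^+ n) * x + x ^+ n * D x.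
Proof. by move=> hx; apply/sder_mull/shomogX. Qed.

Lemma derivation_exp_eq0 (E : series V -> series V) z : ord_linear E -> E 1 = 0 ->
  (forall n, E (z ^+ n * z) = E (z ^+ n) * z + z ^+ n * E z) ->
  ord_ge 1 z -> E (sexp z) = 0 -> E z = 0.
Proof.
move=> hE E1 EX oz e; rewrite (derivation_log hE E1 EX (c := 0)) ?mul0r //.
exact: (ord_lin0 (ord_linear_adser _ _)).
Qed.

(** The summand (ad_x b) is the value at x of the commutator with b, which maps
    e^x to e^x b - b e^x; the Bernoulli series of b - a contributes
    (b - a) e^x. *)
Lemma sder_exp_interval a b x : shomog 0 x -> ord_ge 1 x ->
  D x = ad x b + adser x todd (b - a) ->
  D (sexp x) = sexp x * b - a * sexp x.
Proof.
move=> hx ox Dx.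
rewrite (derivation_exp lD (sder1 d) (fun n => DX n hx) ox) Dx.
rewrite (ord_linD (ord_linear_adser _ _)) adser_expc_todd // mulrDl.
pose E f := ad f b.
have hE : ord_linear E.
  split=> [c f g|n f hf]; last by rewrite -[n]addn0; apply: ord_ge_ad.
  by rewrite /E /ad mulrDr mulrDl -scalerAl -scalerAr scalerBr opprD addrACA.
have E1 : E 1 = 0 by rewrite /E /ad mulr1 mul1r subrr.
have EX n : E (x ^+ n * x) = E (x ^+ n) * x + x ^+ n * E x.
  by rewrite /E /ad mulrBl mulrBr !mulrA [RHS]addrC addrA subrK.
rewrite -(derivation_exp hE E1 EX ox) /E /ad mulrBl.
by rewrite addrA subrK.
Qed.

Lemma sder_sq_mull x y : shomog 0 x ->
  D (D (x * y)) = D (D x) * y + x * D (D y).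
Proof.
move=> hx; rewrite {2}/D sder_mull // /D sderD (sderM _ _ (hD hx)) sder_mull //.
rewrite sub0r exprN1 invrN1 scaleN1r addrA.
by rewrite -/D subrK.
Qed.

(** D o D is a derivation, and it kills e^x by the gauge form of D (e^x). *)
Lemma sder_sq_interval a b x : shomog 0 x -> ord_ge 1 x -> shomog (-1) a ->
  D a = - (a * a) -> D b = - (b * b) ->
  D x = ad x b + adser x todd (b - a) -> D (D x) = 0.
Proof.
move=> hx ox ha Da Db Dx.
have hE : ord_linear (fun f => D (D f)).
  split=> [c f g|n f hf]; first by rewrite !(ord_linP lD).
  exact/(ord_lin_ge lD)/(ord_lin_ge lD).
apply: (derivation_exp_eq0 hE) => //.
- by rewrite /D !sder1 sder0.
- by move=> n; apply/sder_sq_mull/shomogX.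
have De := sder_exp_interval hx ox Dx.
rewrite De (ord_linB lD) {1}/D sder_mull; last exact: shomog_sexp.
rewrite /D (sderM _ _ ha) -/D De Da Db exprN1 invrN1 scaleN1r.
rewrite !(mulrBl, mulrBr, mulNr, mulrN) !mulrA.
by apply/funext => w; rewrite !seriesE; ring.
Qed.

Lemma sder_expN_interval a b x : shomog 0 x -> ord_ge 1 x ->
  D (sexp x) = sexp x * b - a * sexp x ->
  D (sexp (- x)) = sexp (- x) * a - b * sexp (- x).
Proof.
move=> hx ox De.
have hm : shomog 0 (sexp (- x)) by apply/shomog_sexp/shomogN.
have : D (sexp (- x) * sexp x) = 0 by rewrite sexpNr // /D sder1.
rewrite /D sder_mull // -/D De mulrBr !mulrA sexpNr // mul1r => /eqP.
rewrite addr_eq0 opprB => /eqP /(congr1 (fun f => f * sexp (- x))).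
by rewrite -mulrA sexpN // mulr1 mulrBl -!mulrA sexpN // mulr1.
Qed.

(** D + ad_a is a derivation that kills e^z, hence z. *)
Lemma sder_loop a z : shomog 0 z -> ord_ge 1 z ->
  D (sexp z) = sexp z * a - a * sexp z -> D z = z * a - a * z.
Proof.
move=> hz oz De.
pose E f := D f - (f * a - a * f).
have hc : ord_linear (ad a) := ord_linear_ad a.
have EE f : E f = D f + ad a f by rewrite /E opprB.
have hE : ord_linear E.
  split=> [c f g|n f hf]; rewrite !EE.
    by rewrite (ord_linP lD) (ord_linP hc) [c *: (D f + _)]scalerDr addrACA.
  by apply: ord_geD; [apply: (ord_lin_ge lD)|apply: (ord_lin_ge hc)].
apply/eqP; rewrite -subr_eq0; apply/eqP; apply: (derivation_exp_eq0 hE) => //.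
- by rewrite /E /D sder1 mulr1 mul1r !subrr.
- move=> n; rewrite !EE DX // /ad mulrDl mulrDr mulrBl mulrBr !mulrA.
  by apply/funext => w; rewrite !seriesE; ring.
- by rewrite /E De subrr.
Qed.

(** In D (e^x e^y e^{-t}) the contributions of the vertices b and c cancel, and
    those of a remain at both ends. *)
Lemma sder_bch_triangle a b c x y t :
  shomog 0 x -> shomog 0 y -> shomog 0 t ->
  ord_ge 1 x -> ord_ge 1 y -> ord_ge 1 t ->
  D (sexp x) = sexp x * b - a * sexp x ->
  D (sexp y) = sexp y * c - b * sexp y ->
  D (sexp t) = sexp t * c - a * sexp t ->
  D (bch (bch x y) (- t)) = bch (bch x y) (- t) * a - a * bch (bch x y) (- t).
Proof.
move=> hx hy ht ox oy ot Dx Dy Dt.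
have hxy := shomog_bch hx hy; have hNt := shomogN ht.
apply: sder_loop; [exact: shomog_bch|exact: ord_ge_bch|].
rewrite !sexp_bch /D sder_mull; last by apply: (shomogM (i := 0) (j := 0)); apply: shomog_sexp.
rewrite sder_mull; last exact: shomog_sexp.
rewrite -/D Dx Dy (sder_expN_interval ht ot Dt).
rewrite !(mulrBl, mulrBr, mulrDl, mulrDr) !mulrA.
by apply/funext => w; rewrite !seriesE; ring.
Qed.

(** D (D t) = D z + [a, z] + (terms in a, a, t). The first two cancel by the
    formula for D z, the others because D a = - a^2. *)
Lemma sder_sq_triangle a z t : shomog (-1) a -> shomog 1 t ->
  D a = - (a * a) -> D z = z * a - a * z ->
  D t = z - sbracket a t -> D (D t) = 0.
Proof.
move=> ha ht Da Dz Dt; rewrite Dt (ord_linB lD) Dz.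
have ks : ksign (-1) 1 = -1 by rewrite /ksign mulr1 exprN1 invrN1.
have eb : sbracket a t = a * t + t * a.
  by rewrite (sbracketE ha ht) ks scaleN1r opprK.
rewrite eb (ord_linD lD) {1}/D (sderM _ _ ha) {1}/D (sderM _ _ ht) -/D Da Dt eb.
rewrite exprN1 invrN1 expr1z !scaleN1r.
rewrite !(mulrBl, mulrBr, mulrDl, mulrDr, mulNr, mulrN) !mulrA.
by apply/funext => w; rewrite !seriesE; ring.
Qed.

End Interval.

(** * Derivations are determined on generators *)

Section Generators.
Variable V : gradedSet.
Implicit Types (f g h m : series V).

Lemma ord_ge_sbracket i j f g :
  ord_ge i f -> ord_ge j g -> ord_ge (i + j) (sbracket f g).
Proof.
move=> hf hg.
have F u : f u != 0 -> (i <= size u)%N.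
  by apply: contraR; rewrite -ltnNge => /hf ->.
have G u : g u != 0 -> (j <= size u)%N.
  by apply: contraR; rewrite -ltnNge => /hg ->.
move=> w lt; apply/eqP; apply: contraLR lt => /sbracket_supp[[u v] /= <-].
by rewrite size_cat => /orP[/andP[/F + /G +]|/andP[/F + /G +]]; lia.
Qed.

(** Sums of brackets whose left entries are letters. Every bracket of Lie
    polynomials is of this form, by the Jacobi identity. *)
Definition ad_letters f := exists2 g : V -> series V, forall v, free_lie (g v) &
  f = \sum_v sbracket (letter v) (g v).

Lemma ad_lettersP (c : rat) f g : ad_letters f -> ad_letters g -> ad_letters (c *: f + g).
Proof.
move=> [F hF ->] [G hG ->]; exists (fun v => c *: F v + G v).
  by move=> v; apply: free_lie_lin.
by rewrite scaler_sumr -big_split; apply: eq_bigr => v _; rewrite sbracketPr.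
Qed.

Lemma ad_letters_mono i j m h : lie_mono i m -> lie_mono j h ->
  ad_letters (sbracket m h).
Proof.
move=> hm; elim: hm j h => [x|i1 i2 f g hf IHf hg IHg] j h hh.
  exists (fun v => if v == x then h else 0).
    by move=> v; case: ifP => _; [apply: lie_mono_free hh|apply: free_lie_zero].
  rewrite (bigD1 x) //= eqxx big1 ?addr0 // => v /negbTE ->.
  exact: sbracketr0.
have -> : sbracket (sbracket f g) h =
    - ksign i1 i2 *: sbracket g (sbracket f h) + sbracket f (sbracket g h).
  rewrite (sbracket_jacobi (lie_mono_homog hf) (lie_mono_homog hg) (lie_mono_homog hh)).
  by rewrite scaleNr addrC addrK.
by apply: ad_lettersP; [apply: IHg (lie_mono_bracket hf hh)|apply: IHf (lie_mono_bracket hg hh)].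
Qed.

Lemma free_lie_ad_letters f : free_lie f ->
  exists c : V -> rat, ad_letters (f - \sum_v c v *: letter v).
Proof.
move: f; apply: free_lie_mono_ind => [|b f g [c Hf] [c' Hg]|k m hm].
- exists (fun=> 0); exists (fun=> 0); first by move=> v; apply: free_lie_zero.
  by rewrite !big1 ?subrr // => v _; rewrite ?scale0r ?sbracketr0.
- exists (fun v => b * c v + c' v).
  suff -> : b *: f + g - \sum_v (b * c v + c' v) *: letter v =
    b *: (f - \sum_v c v *: letter v) + (g - \sum_v c' v *: letter v).
    exact: ad_lettersP.
  rewrite scalerBr addrACA -opprD scaler_sumr -big_split; congr (_ - _).
  by apply: eq_bigr => v _; rewrite scalerDl scalerA.
case: hm => [x|i j f g hf hg].
- exists (fun v => (v == x)%:R).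
  exists (fun=> 0); first by move=> v; apply: free_lie_zero.
  rewrite (bigD1 x) //= eqxx scale1r big1 => [|v /negbTE ->]; last exact: scale0r.
  by rewrite addr0 subrr big1 // => v _; apply: sbracketr0.
- exists (fun=> 0); rewrite [X in _ - X]big1 ?subr0.
    exact: ad_letters_mono hf hg.
  by move=> v _; rewrite scale0r.
Qed.

Lemma eq_sbracket_letter v f g w :
  (forall u, (size u).+1 = size w -> gdeg v + wdeg u = wdeg w -> f u = g u) ->
  sbracket (letter v) f w = sbracket (letter v) g w.
Proof.
move=> h; apply: eq_bigr => i _.
have H p q : p ++ q = w -> letter v p * f q = letter v p * g q /\
  letter v q * f p = letter v q * g p.
  move=> e; have sw := congr1 size e; have dw := congr1 (@wdeg V) e.
  move: sw dw; rewrite size_cat wdeg_cat /letter => sw dw.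
  split.
    case: (p =P [:: v]) => [ep|_]; last by rewrite !mul0r.
    rewrite h //; first by rewrite -sw ep.
    by rewrite -dw ep /wdeg big_seq1.
  case: (q =P [:: v]) => [ep|_]; last by rewrite !mul0r.
  rewrite h //; first by rewrite -sw ep addn1.
  by rewrite -dw ep addrC /wdeg big_seq1.
by have [-> ->] := H _ _ (cat_take_drop i w).
Qed.

Lemma weight_size w : weight (fun _ : V => 1%N) w = size w.
Proof. exact: sum1_size. Qed.

Lemma free_lie_length f n : in_hatL f -> free_lie (weight_proj (fun=> 1%N) n f).
Proof.
move=> /(in_hatL_approx n.+1)[p lp op].
suff -> : weight_proj (fun=> 1%N) n f = weight_proj (fun=> 1%N) n p by apply: free_lie_weight_proj.
apply/funext => w; rewrite /weight_proj weight_size; case: eqP => // e.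
by apply/eqP; rewrite -subr_eq0; apply/eqP/(op w); rewrite e.
Qed.

(** The decomposition of each homogeneous length n + 1 provides the terms of
    length n of the series y_v; these are assembled, and projected to the only
    degree that contributes. *)
Lemma in_hatL_ad_letters k f : in_hatL f -> shomog k f ->
  exists2 y : V -> series V, forall v, in_hatL (y v) &
    f = \sum_v f [:: v] *: letter v + \sum_v sbracket (letter v) (y v).
Proof.
move=> lf hf.
have : forall n, exists g : V -> series V, (forall v, free_lie (g v)) /\
  exists c : V -> rat, weight_proj (fun=> 1%N) n.+1 f =
    \sum_v sbracket (letter v) (g v) + \sum_v c v *: letter v.
  move=> n; have [c [g hg e]] := free_lie_ad_letters (free_lie_length n.+1 lf).
  by exists g; split=> //; exists c; rewrite -e subrK.
move=> /choice[g hg].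
pose y v : series V := sproj (k - gdeg v) (fun u => g (size u) v u).
have hy v : shomog (k - gdeg v) (y v) by apply: sproj_homog.
have ly v : in_hatL (y v).
  apply: (in_hatL_homogI (hy v)) => n.
  exists (\sum_(m < n) sproj (k - gdeg v) (weight_proj (fun=> 1%N) m (g m v))).
    apply: free_lie_sum => m _; apply/free_lie_proj/free_lie_weight_proj.
    exact: (hg m).1.
  move=> w lt; rewrite !seriesE series_sumE (bigD1 (Ordinal lt)) //=.
  rewrite big1 => [|m ne].
    by rewrite /y /sproj /weight_proj weight_size eqxx addr0 subrr.
  rewrite /sproj /weight_proj weight_size [size w == m]eq_sym.
  have /negbTE -> : (m != size w :> nat) by apply: contra ne => /eqP e; apply/eqP/val_inj.
  exact: if_same.
exists y => //; apply/funext => w; rewrite !seriesE !series_sumE.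
have [wk|wk] := eqVneq (wdeg w) k; last first.
  have z h : shomog k h -> h w = 0.
    by move=> hh; have [//|/hh e] := eqVneq (h w) 0; rewrite e eqxx in wk.
  rewrite z // !big1 ?addr0 // => v _; apply: z.
    by have := shomog_bracket (letter_homog (x := v)) (hy v); rewrite addrC subrK.
  have [->|/hf <-] := eqVneq (f [:: v]) 0.
    by rewrite scale0r; apply: shomog0.
  by apply: shomogZ; rewrite /wdeg big_seq1; apply: letter_homog.
have oy v := in_hatL_ord (ly v).
case: w wk => [|u w] wk.
  rewrite (in_hatL_ord lf) // !big1 ?addr0 // => v _.
    by apply: (ord_ge_sbracket (ord_ge_letter v) (oy v)).
  by rewrite seriesE mulr0.
case: w wk => [|u' w] wk.
  rewrite [X in _ + X]big1 ?addr0 => [|v _].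
    rewrite (bigD1 u) //= big1 ?addr0 => [|v ne]; rewrite seriesE /letter.
      by rewrite eqxx mulr1.
    by rewrite eqseq_cons eq_sym (negbTE ne) mulr0.
  by apply: (ord_ge_sbracket (ord_ge_letter v) (oy v)).
set W := [:: u, u' & w] in wk *.
have lW v : letter v W = 0 by rewrite /letter /W eqseq_cons andbF.
rewrite big1 ?add0r => [|v _]; last by rewrite seriesE lW mulr0.
have [_ [c e]] := hg (size w).+1.
have := congr1 (fun h : series V => h W) e; rewrite /weight_proj weight_size /= eqxx.
rewrite !seriesE !series_sumE [X in _ + X]big1 => [|v _]; last by rewrite seriesE lW mulr0.
rewrite addr0 => ->; apply: eq_bigr => v _; apply: eq_sbracket_letter => t.
move=> [st] dt; rewrite /y /sproj st.
by rewrite -wk -dt addrC addKr eqxx.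
Qed.

(** Continuity of E is not assumed. The finite sum of brackets
    [in_hatL_ad_letters], with infinite series as right entries, lets E raise the
    order of its values by one at each step. *)
Lemma hatL_gens_determine (E : hatL V -> hatL V) :
  (forall (c : rat) x y, E (c *: x + y) = c *: E x + E y) ->
  (forall v, E (hatL_gen v) = 0) ->
  (forall v y, exists c : rat,
    E (bracket (hatL_gen v) y) = c *: bracket (hatL_gen v) (E y)) ->
  forall x, E x = 0.
Proof.
move=> EP Eg EB.
have ED x y : E (x + y) = E x + E y by rewrite -[x]scale1r EP !scale1r.
have E0 : E 0 = 0 by apply: (addrI (E 0)); rewrite -ED !addr0.
suff H n x : ord_ge n (coefs (E x)).
  by move=> x; apply/hatL_inj/ord_ge_eq0 => n; apply: H.
elim: n x => [|n IH] x; first exact: ord_ge0.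
have [s _ [z hz ->]] := homog_span x.
rewrite (big_morph E ED E0) /coefs hatL_val_sum; apply: ord_ge_sum => k _.
have [y ly e] := in_hatL_ad_letters (hatL_in (z k)) (hz k).
pose Y v := mk_hatL (ly v).
have -> : z k = \sum_v hatL_val (z k) [:: v] *: hatL_gen v
   + \sum_v bracket (hatL_gen v) (Y v).
  have valD (p q : hatL V) : hatL_val (p + q) = hatL_val p + hatL_val q by [].
  by apply: hatL_inj; rewrite [LHS]e valD !hatL_val_sum.
rewrite ED !(big_morph E ED E0) big1 ?add0r => [|v _]; last first.
  by rewrite -[_ *: _]addr0 EP Eg E0 scaler0 addr0.
rewrite hatL_val_sum; apply: ord_ge_sum => v _; have [c ->] := EB v (Y v).
by apply/ord_geZ; rewrite -add1n; apply: ord_ge_sbracket (ord_ge_letter v) (IH _).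
Qed.

End Generators.

(** * The derivation of a simplex *)

Section PushSeries.
Variables (V W : gradedSet) (h : V -> W).
Implicit Types (f g : series V).

Lemma pushN f : push h (- f) = - push h f.
Proof. exact: (ord_linN (ord_linear_push h)). Qed.

Lemma pushB f g : push h (f - g) = push h f - push h g.
Proof. by rewrite pushD pushN. Qed.

Lemma pushX f n : push h (f ^+ n) = push h f ^+ n.
Proof. by elim: n => [|n IH]; [apply: push1|rewrite !exprS pushM IH]. Qed.

Lemma push_ad f g : push h (ad f g) = ad (push h f) (push h g).
Proof. by rewrite /ad pushB !pushM. Qed.

Lemma push_adser z (a : nat -> rat) f : ord_ge 1 z ->
  push h (adser z a f) = adser (push h z) a (push h f).
Proof.
move=> oz; rewrite (ord_lin_ssum (ord_linear_push h)); last exact: summable_adser.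
apply: eq_ssum => n; rewrite pushZ; congr (_ *: _).
by elim: n => //= n IH; rewrite push_ad IH.
Qed.

Lemma push_sexp f : ord_ge 1 f -> push h (sexp f) = sexp (push h f).
Proof.
move=> hf; rewrite (ord_lin_ssum (ord_linear_push h)); last exact: summable_exp.
by apply: eq_ssum => n; rewrite pushZ pushX.
Qed.

Lemma push_bch f g : ord_ge 1 f -> ord_ge 1 g ->
  push h (bch f g) = bch (push h f) (push h g).
Proof.
move=> hf hg; have hp := ord_lin_ge (ord_linear_push h).
apply: sexp_inj; [exact/hp/ord_ge_bch|exact: ord_ge_bch|].
by rewrite -push_sexp ?sexp_bch ?pushM ?push_sexp //; apply: ord_ge_bch.
Qed.

End PushSeries.

Section LinearPart.
Variable V : gradedSet.
Implicit Types (f g z : series V).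

Lemma linear_partP (c : rat) f g :
  linear_part (c *: f + g) = c *: linear_part f + linear_part g.
Proof.
apply/funext => w; rewrite !seriesE /linear_part; case: ifP => // _.
by rewrite mulr0 addr0.
Qed.

Lemma linear_part0 f : ord_ge 2 f -> linear_part f = 0.
Proof.
move=> hf; apply/funext => w; rewrite /linear_part; case: eqP => // e.
by rewrite hf // e.
Qed.

Lemma linear_partD f g : linear_part (f + g) = linear_part f + linear_part g.
Proof. by rewrite -[f]scale1r linear_partP !scale1r. Qed.

Lemma linear_partN f : linear_part (- f) = - linear_part f.
Proof.
by rewrite -[- f]addr0 -scaleN1r linear_partP scaleN1r (@linear_part0 0) ?addr0.
Qed.

Lemma linear_part_letter x : linear_part (letter x) = letter x :> series V.
Proof.
apply/funext => w; rewrite /linear_part /letter.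
by case: (w =P [:: x]) => [-> //|_]; rewrite if_same.
Qed.

Lemma linear_part_adser z f : ord_ge 1 z -> ord_ge 1 f ->
  linear_part (adser z todd f) = linear_part f.
Proof.
move=> oz of1; rewrite /adser ssum_recl; last exact: summable_adser.
rewrite linear_partD [X in _ + X]linear_part0 ?addr0.
  by rewrite /= /todd /bernoulli /= fact0 invr1 mulr1 scale1r.
apply: ord_ge_ssum => n; apply: ord_geZ.
by apply: ord_geW (ord_ge_iter_ad (n := n.+1) oz of1); rewrite addn1.
Qed.

Lemma ord_ge_sexp f : ord_ge 1 f -> ord_ge 2 (sexp f - (1 + f)).
Proof.
move=> hf; have := @ssum_tail _ _ 2 (summable_exp hf).
by rewrite !big_ord_recl big_ord0 addr0 !fact0 !invr1 !scale1r.
Qed.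

Lemma linear_part_bch f g : ord_ge 1 f -> ord_ge 1 g ->
  linear_part (bch f g) = linear_part f + linear_part g.
Proof.
move=> hf hg; set z := bch f g; have oz : ord_ge 1 z := ord_ge_bch f g.
rewrite -linear_partD; apply/eqP; rewrite -subr_eq0 -linear_partN -linear_partD.
apply/eqP/linear_part0.
have -> : z - (f + g) = (sexp f - (1 + f)) * sexp g + (1 + f) * (sexp g - (1 + g))
   + f * g - (sexp z - (1 + z)).
  rewrite sexp_bch !(mulrBl, mulrBr, mulrDl, mulrDr) !mul1r !mulr1.
  by apply/funext => w; rewrite !seriesE; ring.
apply: ord_geB; last exact: ord_ge_sexp.
apply: ord_geD; last exact: (ord_geM (m := 1) (n := 1)).
apply: ord_geD; last by apply: (ord_lin_ge (ord_linear_mull _)); apply: ord_ge_sexp.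
by apply: (ord_lin_ge (ord_linear_mulr _)); apply: ord_ge_sexp.
Qed.

End LinearPart.

Section EnumSets.
Variable n : nat.
Implicit Types (A : {set 'I_n}) (s : seq 'I_n) (i j k : 'I_n).

Let lt (i j : 'I_n) := (i < j)%N.

Lemma sorted_enum_set A : sorted lt (enum A).
Proof.
rewrite /enum_mem; apply: sorted_filter => [i j k|]; first exact: ltn_trans.
rewrite -enumT -(sorted_map (f := val) (e' := ltn)) val_enum_ord.
exact: iota_ltn_sorted.
Qed.

Lemma enum_set_sorted A s : sorted lt s -> A =i s -> enum A = s.
Proof.
move=> hs e; apply: (irr_sorted_eq (leT := lt)) => //.
- by move=> i j k; apply: ltn_trans.
- by move=> i; apply: ltnn.
- exact: sorted_enum_set.
- by move=> i; rewrite mem_enum e.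
Qed.

Lemma enum_set2 i j : (i < j)%N -> enum [set i; j] = [:: i; j].
Proof.
by move=> h; apply: enum_set_sorted => [|k]; rewrite /= ?inE /lt ?h.
Qed.

Lemma enum_set3 i j k : (i < j)%N -> (j < k)%N -> enum [set i; j; k] = [:: i; j; k].
Proof.
by move=> h h'; apply: enum_set_sorted => [|l]; rewrite /= ?inE /lt ?h ?h' ?orbA.
Qed.

Lemma enum_set1_inv A i : enum A = [:: i] -> A = [set i].
Proof. by move=> e; apply/setP => l; rewrite -mem_enum e !inE. Qed.

Lemma enum_set2_inv A i j : enum A = [:: i; j] -> A = [set i; j] /\ (i < j)%N.
Proof.
move=> e; have := sorted_enum_set A; rewrite e /= andbT => h; split=> //.
by apply/setP => l; rewrite -mem_enum e !inE.
Qed.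

Lemma enum_set3_inv A i j k : enum A = [:: i; j; k] ->
  [/\ A = [set i; j; k], (i < j)%N & (j < k)%N].
Proof.
move=> e; have := sorted_enum_set A; rewrite e /= andbT => /andP[h h']; split=> //.
by apply/setP => l; rewrite -mem_enum e !inE orbA.
Qed.

End EnumSets.

Lemma enum_lift n (i : 'I_n.+1) (A : {set 'I_n}) :
  enum (lift i @: A) = map (lift i) (enum A).
Proof.
apply: enum_set_sorted => [|k]; last first.
  apply/imsetP/mapP => -[l hl ->]; exists l => //; by rewrite mem_enum in hl *.
rewrite sorted_map; apply: sub_sorted (sorted_enum_set A) => j k /=.
by rewrite !/bump; lia.
Qed.

Section SimplexDerivation.
Variable n : nat.
Implicit Types (A : {set 'I_n.+1}) (i j k : 'I_n.+1).

(** The generator a_A as a series, and 0 for A empty. *)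
Definition alpha A : series (simplex n) := coefs (agen A).

Definition interval_series (V : gradedSet) (a b x : series V) :=
  ad x b + adser x todd (b - a).

(** The value of the differential on a_A. The vertices of A are enumerated in
    increasing order; - a^2 is the Maurer-Cartan equation - [a, a] / 2. Faces of
    dimension at least 3 are sent to 0, which keeps a uniform definition for the
    interval and the triangle and is compatible with cofaces. *)
Definition face_der A : series (simplex n) :=
  match enum A with
  | [:: i] => - (alpha [set i] * alpha [set i])
  | [:: i; j] => interval_series (alpha [set i]) (alpha [set j]) (alpha A)
  | [:: i; j; k] =>
      bch (bch (alpha [set i; j]) (alpha [set j; k])) (- alpha [set i; k])
        - sbracket (alpha [set i]) (alpha A)
  | _ => 0
  end.

Definition simplexd (A : simplex n) : series (simplex n) := face_der (val A).

Lemma alphaE A (hA : A != set0) : alpha A = letter (Sub A hA : simplex n).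
Proof. by rewrite /alpha /agen insubT. Qed.

Lemma alpha0 : alpha set0 = 0.
Proof. by rewrite /alpha /agen insubF // eqxx. Qed.

Lemma agen_val (A : simplex n) : agen (val A) = hatL_gen A.
Proof. by rewrite /agen valK. Qed.

Lemma shomog_alpha (m : int) A : #|A|%:Z - 2%:Z = m -> shomog m (alpha A).
Proof.
move=> <-; have [->|hA] := eqVneq A set0; first by rewrite alpha0; apply: shomog0.
by rewrite alphaE; apply: letter_homog.
Qed.

Lemma shomog_alpha1 i : shomog (-1) (alpha [set i]).
Proof. by apply: shomog_alpha; rewrite cards1. Qed.

Lemma shomog_alpha2 i j : (i < j)%N -> shomog 0 (alpha [set i; j]).
Proof. by move=> h; apply: shomog_alpha; rewrite cardE enum_set2. Qed.

Lemma shomog_alpha3 i j k : (i < j)%N -> (j < k)%N -> shomog 1 (alpha [set i; j; k]).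
Proof. by move=> h h'; apply: shomog_alpha; rewrite cardE enum_set3. Qed.

Lemma in_hatL_alpha A : in_hatL (alpha A).
Proof. exact: hatL_in. Qed.

Lemma ord_ge_alpha A : ord_ge 1 (alpha A).
Proof. exact/in_hatL_ord/in_hatL_alpha. Qed.

Lemma face_der1 i : face_der [set i] = - (alpha [set i] * alpha [set i]).
Proof. by rewrite /face_der enum_set1. Qed.

Lemma face_der2 i j : (i < j)%N -> face_der [set i; j] =
  interval_series (alpha [set i]) (alpha [set j]) (alpha [set i; j]).
Proof. by move=> h; rewrite /face_der enum_set2. Qed.

Lemma face_der3 i j k : (i < j)%N -> (j < k)%N -> face_der [set i; j; k] =
  bch (bch (alpha [set i; j]) (alpha [set j; k])) (- alpha [set i; k])
        - sbracket (alpha [set i]) (alpha [set i; j; k]).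
Proof. by move=> h h'; rewrite /face_der enum_set3. Qed.

Lemma face_der_ind (P : {set 'I_n.+1} -> series (simplex n) -> Prop) :
  (forall i, P [set i] (- (alpha [set i] * alpha [set i]))) ->
  (forall i j, (i < j)%N -> P [set i; j]
     (interval_series (alpha [set i]) (alpha [set j]) (alpha [set i; j]))) ->
  (forall i j k, (i < j)%N -> (j < k)%N -> P [set i; j; k]
     (bch (bch (alpha [set i; j]) (alpha [set j; k])) (- alpha [set i; k])
        - sbracket (alpha [set i]) (alpha [set i; j; k]))) ->
  (forall A, P A 0) -> forall A, P A (face_der A).
Proof.
move=> P1 P2 P3 P0 A; rewrite /face_der; case E : (enum A) => [|i [|j [|k [|? ?]]]] //.
- by rewrite (enum_set1_inv E).
- by have [-> h] := enum_set2_inv E; apply: P2.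
- by have [-> h h'] := enum_set3_inv E; apply: P3.
Qed.

Lemma sqr_sbracket (V : gradedSet) (a : series V) : shomog (-1) a ->
  a * a = 2^-1 *: sbracket a a.
Proof.
move=> ha; rewrite (sbracketE ha ha) /ksign mulrNN mulr1 expr1z scaleN1r opprK.
by rewrite -mulr2n -scaler_nat scalerA mulVf ?scale1r.
Qed.

Lemma shomog_face_der A : shomog (#|A|%:Z - 2%:Z - 1) (face_der A).
Proof.
move: A; apply: (face_der_ind (P := fun A f => shomog (#|A|%:Z - 2%:Z - 1) f))
  => [i|i j h|i j k h h'|A]; last exact: shomog0.
- rewrite cards1; apply: shomogN.
  by apply: (shomogM (i := -1) (j := -1)); apply: shomog_alpha1.
- rewrite cardE enum_set2 // [_ - _ - 1](_ : _ = -1) //; apply: shomogD.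
    by apply: shomog_ad; [apply: shomog_alpha2|apply: shomog_alpha1].
  apply: shomog_adser; first exact: shomog_alpha2.
  by apply: shomogB; apply: shomog_alpha1.
- have h'' := ltn_trans h h'; rewrite cardE enum_set3 // [_ - _ - 1](_ : _ = 0) //; apply: shomogB.
    by apply: shomog_bch; [apply: shomog_bch|apply: shomogN]; apply: shomog_alpha2.
  by have := shomog_bracket (shomog_alpha1 (i := i)) (shomog_alpha3 h h'); rewrite addNr.
Qed.

(** After reassociation the product is x * (y * (- t)), where the letter x does
    not occur in y * (- t), nor y in - t. *)
Lemma in_hatL_bch_edges i j k : (i < j)%N -> (j < k)%N ->
  in_hatL (bch (bch (alpha [set i; j]) (alpha [set j; k])) (- alpha [set i; k])).
Proof.
move=> h h'; have h'' := ltn_trans h h'.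
have edge (p q : 'I_n.+1) : (p < q)%N -> exists2 x : simplex n, val x = [set p; q] &
    alpha [set p; q] = letter x /\ gdeg x = 0.
  move=> hpq; have nz : [set p; q] != set0 by apply/set0Pn; exists p; rewrite !inE eqxx.
  exists (Sub [set p; q] nz); first exact: SubK.
  by split; [rewrite alphaE|rewrite /= /face_deg SubK cardE enum_set2].
have [x vx [ex dx]] := edge i j h; have [y vy [ey dy]] := edge j k h'.
have [t vt [et dt]] := edge i k h''.
have ne (p q : 'I_n.+1) : (p < q)%N -> (p == q) = false.
  by move=> hpq; apply/negbTE; apply: contraTneq hpq => ->; rewrite ltnn.
have nxy : y != x.
  apply/eqP => /(congr1 val); rewrite vx vy => /setP/(_ i).
  by rewrite !inE eqxx (ne i j) ?(ne i k).
have nxt : t != x.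
  apply/eqP => /(congr1 val); rewrite vx vt => /setP/(_ j).
  by rewrite !inE eqxx orbT eq_sym (ne i j) ?(ne j k).
have nyt : t != y.
  apply/eqP => /(congr1 val); rewrite vy vt => /setP/(_ i).
  by rewrite !inE eqxx (ne i j) ?(ne i k).
have oN : ord_ge 1 (- letter t) by apply/ord_geN/ord_ge_letter.
have aN u : t != u -> avoids u (- letter t).
  by move=> /avoids_letter a w uw; rewrite seriesE a ?oppr0.
have hN : shomog 0 (- letter t) by apply: shomogN; rewrite -dt; apply: letter_homog.
have hy : shomog 0 (letter y) by rewrite -dy; apply: letter_homog.
rewrite bchA ex ey et; apply: in_hatL_bch_letter => //.
- exact: shomog_bch.
- apply: in_hatL_bch_letter => //; last exact: aN.
  exact/in_hatLN/in_hatL_letter.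
- by apply: avoids_bch => //; [apply: ord_ge_letter|apply: avoids_letter|apply: aN].
Qed.

Lemma in_hatL_face_der A : in_hatL (face_der A).
Proof.
move: A; apply: (face_der_ind (P := fun _ f => in_hatL f))
  => [i|i j h|i j k h h'|A]; last exact: in_hatL0.
- rewrite sqr_sbracket; last exact: shomog_alpha1.
  by apply/in_hatLN/in_hatLZ/in_hatL_bracket; apply: in_hatL_alpha.
- apply: in_hatLD.
    rewrite -sbracket_ad; last exact: shomog_alpha2.
    by apply: in_hatL_bracket; apply: in_hatL_alpha.
  apply: (in_hatL_adser (k := -1)); try exact: in_hatL_alpha.
  + exact: shomog_alpha2.
  + by apply: in_hatLB; apply: in_hatL_alpha.
  + by apply: shomogB; apply: shomog_alpha1.
- apply: in_hatLB; first exact: in_hatL_bch_edges.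
  by apply: in_hatL_bracket; apply: in_hatL_alpha.
Qed.

Lemma shomog_simplexd (x : simplex n) : shomog (gdeg x - 1) (simplexd x).
Proof. exact: shomog_face_der. Qed.

Lemma in_hatL_simplexd (x : simplex n) : in_hatL (simplexd x).
Proof. exact: in_hatL_face_der. Qed.

Lemma ord_ge_simplexd (x : simplex n) : ord_ge 1 (simplexd x).
Proof. exact/in_hatL_ord/in_hatL_simplexd. Qed.

Lemma sder_alpha A : sder simplexd (alpha A) = face_der A.
Proof.
have [->|hA] := eqVneq A set0; last by rewrite alphaE sder_letter /simplexd SubK.
by rewrite alpha0 sder0 /face_der enum_set0.
Qed.

Lemma sder_exp_edge i j : (i < j)%N ->
  sder simplexd (sexp (alpha [set i; j])) =
    sexp (alpha [set i; j]) * alpha [set j] - alpha [set i] * sexp (alpha [set i; j]).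
Proof.
move=> h; apply: sder_exp_interval.
- exact: ord_ge_simplexd.
- exact: shomog_alpha2.
- exact: ord_ge_alpha.
- by rewrite sder_alpha face_der2.
Qed.

Lemma sder_sq_alpha A : sder simplexd (sder simplexd (alpha A)) = 0.
Proof.
rewrite sder_alpha; move: A; have hd := shomog_simplexd; have od := ord_ge_simplexd.
have d1 i : sder simplexd (alpha [set i]) = - (alpha [set i] * alpha [set i]).
  by rewrite sder_alpha face_der1.
apply: (face_der_ind (P := fun _ f => sder simplexd f = 0)) => [i|i j h|i j k h h'|A].
- rewrite sderN (sderM _ _ (shomog_alpha1 (i := i))) d1 exprN1 invrN1 scaleN1r.
  by rewrite mulNr mulrN mulrA opprK addNr oppr0.
- rewrite -face_der2 // -sder_alpha.
  apply: (sder_sq_interval hd od _ _ (shomog_alpha1 (i := i)) (d1 i) (d1 j)).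
  + exact: shomog_alpha2.
  + exact: ord_ge_alpha.
  + by rewrite sder_alpha face_der2.
- have h'' := ltn_trans h h'.
  rewrite -face_der3 // -sder_alpha.
  have Dt := sder_alpha [set i; j; k]; rewrite face_der3 // in Dt.
  apply: (sder_sq_triangle od _ _ (d1 i) _ Dt).
  + exact: shomog_alpha1.
  + exact: shomog_alpha3.
  apply: (sder_bch_triangle od (b := alpha [set j]) (c := alpha [set k]));
    try exact: ord_ge_alpha; try exact: shomog_alpha2; exact: sder_exp_edge.
- exact: sder0.
Qed.

Definition simplexD : hatL (simplex n) -> hatL (simplex n) :=
  hatL_der shomog_simplexd in_hatL_simplexd.

Lemma simplexD_derivation : is_derivation simplexD.
Proof. exact: hatL_der_derivation. Qed.

Lemma simplexD_differential : is_differential simplexD.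
Proof.
split=> [|x]; first exact: simplexD_derivation.
apply: hatL_inj; apply: (sder_sq0 shomog_simplexd) => v.
by have := sder_sq_alpha (val v); rewrite sder_alpha.
Qed.

Lemma coefs_simplexD A : coefs (simplexD (agen A)) = face_der A.
Proof. exact: sder_alpha. Qed.

Lemma simplexD_maurer_cartan i : maurer_cartan simplexD (agen [set i]).
Proof.
split; first exact: shomog_alpha1.
apply: hatL_inj; rewrite [LHS](_ : _ = face_der [set i] +
  2^-1 *: sbracket (alpha [set i]) (alpha [set i])); last by rewrite -coefs_simplexD.
by rewrite face_der1 (sqr_sbracket (shomog_alpha1 (i := i))) addNr.
Qed.

Lemma simplexD_interval i j : (i < j)%N ->
  LS_interval simplexD (agen [set i]) (agen [set j]) (agen [set i; j]).
Proof.
move=> h; split; [exact: simplexD_maurer_cartan..|].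
have hx := shomog_alpha2 h.
rewrite coefs_simplexD face_der2 // /interval_series; congr (_ + _).
  by rewrite -sbracket_ad.
apply: eq_ssum => m; congr (_ *: _); rewrite -iter_sbracket_ad //.
by elim: m => //= m ->.
Qed.

End SimplexDerivation.

(** * Cofaces, linear part and uniqueness *)

Section Coface.
Variables (n : nat) (i : 'I_n.+2).

Let h : simplex n -> simplex n.+1 := lift_face (n := n) i.

Lemma push_alpha (A : {set 'I_n.+1}) : push h (alpha A) = alpha (lift i @: A).
Proof. by rewrite /alpha -coface_agen. Qed.

Lemma push_face_der (A : {set 'I_n.+1}) : push h (face_der A) = face_der (lift i @: A).
Proof.
have l1 (j : 'I_n.+1) : lift i @: [set j] = [set lift i j] by rewrite imset_set1.
have l2 (j k : 'I_n.+1) : lift i @: [set j; k] = [set lift i j; lift i k].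
  by rewrite imsetU1 imset_set1.
have al := ord_ge_alpha (n := n).
rewrite /face_der enum_lift; case E : (enum A) => [|j [|k [|l [|? ?]]]] /=; try exact: push0.
- by rewrite pushN pushM push_alpha l1.
- have [eA lt] := enum_set2_inv E.
  rewrite /interval_series pushD push_ad push_adser //.
  by rewrite pushB !push_alpha !l1.
- have [eA lt lt'] := enum_set3_inv E.
  rewrite pushB (push_bracket_homog (@lift_face_deg n i)
    (shomog_alpha1 (i := j)) (shomog_alpha (erefl (#|A|%:Z - 2%:Z)))).
  rewrite !push_bch //; try exact: ord_ge_bch; try exact/ord_geN.
  by rewrite pushN !push_alpha !l1 !l2.
Qed.

Lemma push_sder_simplexd f : push h (sder (@simplexd n) f) = sder (@simplexd n.+1) (push h f).
Proof.
apply: push_sder => v; first exact: lift_face_deg.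
by rewrite [LHS]push_face_der.
Qed.

(** Both sides are bilinear, so it is enough to compare them on homogeneous
    elements. *)
Lemma coface_bracket (x y : hatL (simplex n)) :
  coface i (bracket x y) = bracket (coface i x) (coface i y).
Proof.
have cP c (u v : hatL (simplex n)) : coface i (c *: u + v) = c *: coface i u + coface i v.
  by apply: hatL_inj; apply: pushP.
pose F (u v : hatL (simplex n)) : hatL (simplex n.+1) :=
  coface i (bracket u v) - bracket (coface i u) (coface i v).
suff F0 u v : F u v = 0 by apply/eqP; rewrite -subr_eq0; apply/eqP/F0.
apply: (graded_lie_homog_ext (F := fun u => F u v)) u => [c u u'|k u hu].
  by rewrite /F !(bracketPl, cP) opprD addrACA -scalerBr.
apply: (graded_lie_homog_ext (F := F u)) v => [c v v'|l v hv].
  by rewrite /F !(bracketPr, cP) opprD addrACA -scalerBr.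
apply/eqP; rewrite subr_eq0; apply/eqP/hatL_inj.
exact: (push_bracket_homog (@lift_face_deg n i) hu hv).
Qed.

Lemma coface_dgl_morphism :
  dgl_morphism (@simplexD n) (@simplexD n.+1) (coface i).
Proof.
split=> [c x y|k x hx|x y|x].
- by apply: hatL_inj; apply: pushP.
- exact: (push_homog (@lift_face_deg n i)).
- exact: coface_bracket.
- by apply: hatL_inj; apply: push_sder_simplexd.
Qed.

End Coface.

Section SimplicialLinearPart.
Variable n : nat.
Implicit Types (A : {set 'I_n.+1}) (i j k : 'I_n.+1).

(** The simplicial boundary, as a sum over the increasing enumeration of the
    vertices, where the sign can be computed. *)
Definition face_sum A : series (simplex n) :=
  \sum_(i <- enum A) (-1) ^+ count (fun k : 'I_n.+1 => k < i)%N (enum A) *: alpha (A :\ i).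

Lemma face_sumE A :
  coefs (\sum_(i in A) (-1) ^+ #|[set k in A | (k < i)%N]| *: agen (A :\ i)) =
  face_sum A.
Proof.
rewrite /coefs -big_enum hatL_val_sum; apply: eq_bigr => i _.
rewrite [LHS](_ : _ = (-1) ^+ #|[set k in A | (k < i)%N]| *: alpha (A :\ i)) //.
congr (_ ^+ _ *: _); rewrite -size_filter cardE; congr size.
apply: enum_set_sorted.
  apply: sorted_filter (sorted_enum_set A).
  by move=> a b c; apply: ltn_trans.
by move=> k; rewrite inE mem_filter mem_enum andbC.
Qed.

Lemma linear_part_alpha A : linear_part (alpha A) = alpha A.
Proof.
have [->|hA] := eqVneq A set0; first by rewrite alpha0 linear_part0 //; apply: ord_ge_zero.
by rewrite alphaE linear_part_letter.
Qed.

Lemma linear_part_face_der A : (#|A| <= 3)%N -> linear_part (face_der A) = face_sum A.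
Proof.
have lP := linear_part_alpha; have oA := ord_ge_alpha (n := n).
have o2 f g : ord_ge 1 f -> ord_ge 1 g -> ord_ge 2 (f * g : series (simplex n)).
  exact: (ord_geM (m := 1) (n := 1)).
have ne i j : (i < j)%N -> ((i == j) = false) * ((j == i) = false).
  by move=> h; split; apply/negbTE; apply: contraTneq h => ->; rewrite ltnn.
have gt i j : (i < j)%N -> (j < i)%N = false by move=> h; apply/leq_gtF/ltnW.
rewrite cardE /face_sum; case E : (enum A) => [|i [|j [|k [|? ?]]]] // _.
- by rewrite big_nil /face_der E linear_part0 //; apply: ord_ge_zero.
- rewrite (enum_set1_inv E) face_der1 big_seq1 setDv alpha0 scaler0.
  by apply/linear_part0/ord_geN/o2.
- have [-> h] := enum_set2_inv E; have [n1 n2] := ne i j h.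
  have e1 : [set i; j] :\ i = [set j].
    by apply/setP => l; rewrite !inE; case: eqP => // ->; rewrite n1.
  have e2 : [set i; j] :\ j = [set i].
    by apply/setP => l; rewrite !inE; case: (l =P j) => [->|_] /=; rewrite ?n2 ?orbF.
  rewrite face_der2 // /interval_series linear_partD [X in X + _]linear_part0 ?add0r; last first.
    exact: (ord_ge_ad (m := 1) (n := 1)).
  rewrite linear_part_adser //; last exact: ord_geB.
  rewrite linear_partD linear_partN !lP big_cons big_seq1 e1 e2 /= !ltnn h.
  by rewrite (gt i j) //= expr0 expr1 scale1r scaleN1r.
have [-> h h'] := enum_set3_inv E; have h'' := ltn_trans h h'.
have [n1 n2] := ne i j h; have [n3 n4] := ne j k h'; have [n5 n6] := ne i k h''.
have e1 : [set i; j; k] :\ i = [set j; k].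
  by apply/setP => l; rewrite !inE; case: (l =P i) => //= ->; rewrite n1 n5.
have e2 : [set i; j; k] :\ j = [set i; k].
  by apply/setP => l; rewrite !inE; case: (l =P j) => [->|_] /=; rewrite ?n2 ?n3 ?orbF.
have e3 : [set i; j; k] :\ k = [set i; j].
  by apply/setP => l; rewrite !inE; case: (l =P k) => [->|_] /=; rewrite ?n4 ?n6 ?orbF.
rewrite face_der3 // linear_partD linear_partN [linear_part (sbracket _ _)]linear_part0; last first.
  exact: (ord_ge_sbracket (i := 1) (j := 1)).
rewrite subr0 !linear_part_bch //; try exact: ord_ge_bch; try exact: ord_geN.
rewrite linear_partN !lP !big_cons big_nil e1 e2 e3 /= !ltnn h h' h''.
rewrite (gt i j) ?(gt i k) ?(gt j k) //= !expr0 expr1 expr2 mulrNN mulr1 !scale1r scaleN1r addr0.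
by apply/funext => w; rewrite !seriesE; ring.
Qed.

End SimplicialLinearPart.

Lemma set_I3_ind (P : {set 'I_3} -> Prop) :
  P set0 -> P [set o0] -> P [set o1] -> P [set o2] -> P [set o0; o1] ->
  P [set o1; o2] -> P [set o0; o2] -> P [set o0; o1; o2] -> forall A, P A.
Proof.
move=> P0 P1 P2 P3 P4 P5 P6 P7 A.
have -> : A = (if o0 \in A then [set o0] else set0)
    :|: (if o1 \in A then [set o1] else set0) :|: (if o2 \in A then [set o2] else set0).
  apply/setP => -[[|[|[|//]]] hi].
  - rewrite (_ : Ordinal hi = o0); last exact: val_inj.
    by case: ifP; case: ifP; case: ifP; rewrite !inE.
  - rewrite (_ : Ordinal hi = o1); last exact: val_inj.
    by case: ifP; case: ifP; case: ifP; rewrite !inE.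
  - rewrite (_ : Ordinal hi = o2); last exact: val_inj.
    by case: ifP; case: ifP; case: ifP; rewrite !inE.
by case: ifP; case: ifP; case: ifP; rewrite ?set0U ?setU0.
Qed.

Lemma simplexD_triangle_derivation : triangle_derivation (@simplexD 2).
Proof.
split; [exact: simplexD_derivation|exact: simplexD_interval..|].
rewrite [LHS](_ : _ = face_der [set o0; o1; o2] +
  sbracket (alpha [set o0]) (alpha [set o0; o1; o2])); last by rewrite -coefs_simplexD.
by rewrite face_der3 // subrK.
Qed.

Lemma simplexD_triangle_model : is_triangle_model (@simplexD 2).
Proof.
split; [exact: simplexD_differential|exact: simplexD_maurer_cartan| |].
  move=> A; rewrite face_sumE coefs_simplexD linear_part_face_der //.
  by have := max_card (mem A); rewrite card_ord.
exists (@simplexD 1); split; [exact: simplexD_differential| |exact: coface_dgl_morphism].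
have -> : [set: 'I_2] = [set ord0; ord_max].
  by apply/setP => -[[|[|//]] hi]; rewrite !inE.
exact: simplexD_interval.
Qed.

(** The five conditions prescribe the values on the seven generators: the
    Maurer-Cartan equations on vertices, the interval formulas on edges and the
    twisted identity on a012. *)
Lemma triangle_derivation_unique D D' :
  triangle_derivation D -> triangle_derivation D' -> D' =1 D.
Proof.
move=> [dD [m0 m1 i01] [_ m2 i12] [_ _ i02] t] [dD' [m0' m1' i01'] [_ m2' i12'] [_ _ i02'] t'].
have DP := derivP dD; have DP' := derivP dD'.
have D0 : D 0 = 0 by have := DP (-1) 0 0; rewrite scaler0 addr0 scaleN1r addNr.
have D0' : D' 0 = 0 by have := DP' (-1) 0 0; rewrite scaler0 addr0 scaleN1r addNr.
have mc a : maurer_cartan D a -> maurer_cartan D' a -> D' a = D a.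
  by move=> [_ e] [_ /eqP e']; move: e'; rewrite -e => /eqP /addIr.
have eqA : forall A, D' (agen A) = D (agen A).
  apply: set_I3_ind.
  - have -> : agen set0 = 0 :> hatL (simplex 2) by rewrite /agen insubF ?eqxx.
    by rewrite D0 D0'.
  - exact: mc m0 m0'.
  - exact: mc m1 m1'.
  - exact: mc m2 m2'.
  - by apply: hatL_inj; rewrite [LHS]i01' [RHS]i01.
  - by apply: hatL_inj; rewrite [LHS]i12' [RHS]i12.
  - by apply: hatL_inj; rewrite [LHS]i02' [RHS]i02.
  - by apply: (addIr (bracket a0 a012)); apply: hatL_inj; rewrite [LHS]t' [RHS]t.
move=> x; apply/eqP; rewrite -subr_eq0; apply/eqP; move: x.
apply: hatL_gens_determine => [c x y|v|v y].
- by rewrite DP DP' opprD addrACA -scalerBr.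
- by rewrite -agen_val eqA subrr.
exists ((-1) ^ gdeg v).
have hv : homog (gdeg v) (hatL_gen v) by apply: letter_homog.
rewrite (deriv_bracket dD _ hv) (deriv_bracket dD' _ hv) -agen_val eqA.
rewrite opprD addrACA subrr add0r -scalerBr; congr (_ *: _).
by rewrite [D' y - D y]addrC -[- D y]scaleN1r bracketPr scaleN1r addrC.
Qed.

Theorem proposition2p7 :
  exists D : hatL (simplex 2) -> hatL (simplex 2),
    [/\ triangle_derivation D,
        is_triangle_model D &
        forall D' : hatL (simplex 2) -> hatL (simplex 2),
          triangle_derivation D' -> D' =1 D].
Proof.
exists (@simplexD 2); split.
- exact: simplexD_triangle_derivation.
- exact: simplexD_triangle_model.
- by move=> D'; apply: triangle_derivation_unique simplexD_triangle_derivation.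
Qed.
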